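(* Let $(X,d)$ be a complete and separable (possibly extended) metric space, let $\xi\in\mathrm{Lip}_b(X)$ satisfy the uniform lower bound $P:=\inf_X\xi+1/2>0$, and set $\zeta([x,r]):=\xi(x)r^2$ on the cone $\mathfrak C$. Then for every $t\in[0,1]$ we have $$\mathscr Q_t\zeta([x,r])=\xi_t(x)r^2,\qquad\text{where}\quad \xi_t(x):=\mathscr P_t\xi(x)$$ and $$\mathscr P_t\xi(x):=\inf_{x'\in X}\left(\frac{\xi(x')}{1+2t\xi(x')}+\frac{\sin^2(d_{\pi/2}(x,x'))}{2t(1+2t\xi(x'))}\right)=\inf_{x'\in X}\frac1{2t}\left(1-\frac{\cos^2(d_{\pi/2}(x,x'))}{1+2t\xi(x')}\right).$$ Moreover, for every $R>0$ we have $$\xi_t(x)r^2=\inf_{[x',r']\in\mathfrak C,\ r'\le R}\Big(\xi(x')(r')^2+\frac1{2t}d_{\mathfrak C}^2([x,r],[x',r'])\Big)\qquad\text{for all }x\in X,\ r\le PR.$$ The map $t\mapsto\xi_t$ is Lipschitz from $[0,1]$ to $C_b(X)$ with $\xi_t\in\mathrm{Lip}_b(X)$ for every $t\in[0,1]$. Moreover, $\xi_t$ is a subsolution to the generalized Hamilton-Jacobi equation: $$\partial_t^+\xi_t(x)+\frac12|\mathrm D_X\xi_t|_a^2(x)+2\xi_t^2(x)\le0\qquad\text{for every }x\in X\text{ and }t\in[0,1].$$ For every $x\in X$ the map $t\mapsto\xi_t(x)$ is differentiable with at most countably many exceptions. If $(X,d)$ is a length space, the inequality holds with equality and $|\mathrm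 D_X\xi_t|_a(x)=|\mathrm D_X\xi_t|(x)$ for every $x\in X$ and $t\in[0,1]$: $$\partial_t^+\xi_t(x)+\frac12|\mathrm D_X\xi_t|_a^2(x)+2\xi_t^2(x)=0,\qquad|\mathrm D_X\xi_t|_a(x)=|\mathrm D_X\xi_t|(x).$$
   Context: $d_a=\min(d,a)$. $\mathrm{Lip}_b(X)$: bounded Lipschitz real functions on $X$; $C_b(X)$: bounded continuous real functions with the uniform norm. $\partial_t^+$ is the partial right derivative with respect to $t$. Cone: $\mathfrak C$ is the quotient of $X\times[0,\infty)$ identifying all points $(x,0)$ to the vertex; $[x,r]$ is the class of $(x,r)$; $d_{\mathfrak C}^2([x_1,r_1],[x_2,r_2])=r_1^2+r_2^2-2r_1r_2\cos(d_\pi(x_1,x_2))$. Hopf-Lax formula: $\mathscr Q_tf(y)=\inf_{y'\in\mathfrak C}\big(f(y')+\frac1{2t}d_{\mathfrak C}^2(y,y')\big)$ for $t>0$. At $t=0$ the formulas are understood as $\mathscr Q_0\zeta=\zeta$ and $\xi_0=\mathscr P_0\xi=\xi$. For a locally Lipschitz $f:X\to\mathbb R$, the metric slope and asymptotic Lipschitz constant are $$|\mathrm D_Xf|(z)=\limsup_{x\to z}\frac{|f(x)-f(z)|}{d(x,z)},\qquad|\mathrm D_Xf|_a(z)=\lim_{\rho\downarrow0}\ \sup_{x,y\in B_\rho(z),\,x\ne y}\frac{|f(y)-f(x)|}{d(x,y)},$$ both set to $0$ at isolated points. A length space is a (possibly extended) metric space in which the distance of any couple of points is the infimum of the lengths of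 absolutely continuous curves joining them.
   Formalization: The formula with r' ≤ R also assumes r ≤ (1+2t inf ξ)R (automatic if P ≤ 1; it can fail otherwise), and the Hamilton-Jacobi inequality, equality and slope identity are stated for t in (0,1], since they can fail at t = 0. *)

(* Defs.v *)
From HB Require Import structures.
From mathcomp Require Import all_boot all_order all_algebra.
From mathcomp Require Import generic_quotient.
From mathcomp Require Import all_classical all_reals all_analysis.
Set Implicit Arguments.
Unset Strict Implicit.
Unset Printing Implicit Defensive.
Import Order.TTheory GRing.Theory Num.Theory.
Import numFieldNormedType.Exports.

Local Open Scope classical_set_scope.
Local Open Scope ring_scope.
Local Open Scope quotient_scope.

(* A possibly extended metric space is a pseudometric space [X] that is
   Hausdorff, with distance [edist : X * X -> \bar R], the infimum of the radii
   [r] such that [ball x r y].  Any extended distance [d] arises in this way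
   from [ball x r y := (d x y < r%:E)%E]. *)

Definition separable_space (T : topologicalType) : Prop :=
  exists2 D : set T, countable D & dense D.

Section ExtendedMetric.
Context (R : realType) (X : pseudoMetricType R).

Definition trunc_dist (a : R) (x y : X) : R :=
  fine (Order.min (edist (x, y)) a%:E).

(* [0 < L] because [0 * +oo = 0] in [\bar R]. *)
Definition Lipb (f : X -> R) : Prop :=
  bounded_fun f /\
  exists2 L : R, 0 < L &
    forall x y : X, (`|f x - f y|%:E <= L%:E * edist (x, y))%E.

Definition Cb (f : X -> R) : Prop := bounded_fun f /\ continuous f.

Definition unif_norm (f : X -> R) : \bar R :=
  ereal_sup [set `|f x|%:E | x in [set: X]].

Definition slope (f : X -> R) (z : X) : \bar R :=
  if `[< isolated [set: X] z >] then 0%E else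
  limf_esup (fun x => (`|f x - f z| / fine (edist (x, z)))%:E) z^'.

(* The difference quotients over pairs of distinct points of the open
   [edist]-ball of radius [rho], where [edist] is finite. *)
Definition diff_quotients (f : X -> R) (z : X) (rho : R) : set (\bar R) :=
  [set q | exists x y : X,
    [/\ (edist (z, x) < rho%:E)%E, (edist (z, y) < rho%:E)%E, x <> y &
        q = (`|f y - f x| / fine (edist (x, y)))%:E]].

Definition asym_lip (f : X -> R) (z : X) : \bar R :=
  if `[< isolated [set: X] z >] then 0%E else
  lim (ereal_sup (diff_quotients f z rho) @[rho --> (0 : R)^'+]).

(* Curves are parametrized on [0, 1]; values outside are irrelevant. *)
Definition abs_cont_curve (g : R -> X) : Prop :=
  exists2 m : R -> R,
    (@lebesgue_measure R).-integrable `[0, 1] (EFin \o m) &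
    forall s t : R, 0 <= s -> s <= t -> t <= 1 ->
      (edist (g s, g t) <= \int[@lebesgue_measure R]_(u in `[s, t]) (m u)%:E)%E.

Definition curve_length (g : R -> X) : \bar R :=
  ereal_sup [set (\sum_(i < size s)
                    edist (g (nth 1%R (0%R :: s) i), g (nth 1%R s i)))%E
            | s in (itv_partition 0 1 : set (seq R))].

Definition is_length_space : Prop :=
  forall x y : X,
    edist (x, y) = ereal_inf [set curve_length g
      | g in [set g | [/\ abs_cont_curve g, g 0 = x & g 1 = y]]].

End ExtendedMetric.

Section Cone.
Context (R : realType) (X : pseudoMetricType R).

Definition cone_rel (p q : X * {nonneg R}) : bool :=
  (p == q) || ((p.2%:num == 0) && (q.2%:num == 0)).

Lemma cone_rel_equiv : equiv_class_of cone_rel.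
Proof.
split=> [p|p q|q p r]; rewrite /cone_rel.
- by rewrite eqxx.
- by rewrite eq_sym andbC.
- move=> /orP[/eqP->//|/andP[p0 q0]] /orP[/eqP<-|/andP[_ r0]].
    by rewrite p0 q0 orbT.
  by rewrite p0 r0 orbT.
Qed.

Canonical cone_equiv := EquivRelPack cone_rel_equiv.

Definition cone : Type := {eq_quot cone_equiv}.

Definition cone_pt (x : X) (r : {nonneg R}) : cone := \pi_cone (x, r).

Definition cone_base (y : cone) : X := (repr y).1.
Definition cone_radius (y : cone) : R := (repr y).2%:num.

(* [cone_base] is an arbitrary choice at the vertex, but the functions below
   do not depend on it: see [cone_radiusE], [cone_quadE] and [cone_sqdistE]. *)
Definition cone_quad (xi : X -> R) (y : cone) : R :=
  xi (cone_base y) * cone_radius y ^+ 2.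

Definition cone_sqdist (y1 y2 : cone) : R :=
  cone_radius y1 ^+ 2 + cone_radius y2 ^+ 2
  - 2 * cone_radius y1 * cone_radius y2
    * cos (trunc_dist pi (cone_base y1) (cone_base y2)).

Lemma cone_ptP x r : let y := cone_pt x r in
  cone_radius y = r%:num /\ (r%:num != 0 -> cone_base y = x).
Proof.
rewrite /cone_radius /cone_base /cone_pt; case: piP => -[x' r'] /eqmodP/=.
rewrite /cone_rel/= => /orP[/eqP[-> ->]//|/andP[/eqP-> /eqP->]].
by rewrite eqxx.
Qed.

Lemma cone_radiusE x r : cone_radius (cone_pt x r) = r%:num.
Proof. by have [] := cone_ptP x r. Qed.

Lemma cone_quadE xi x r : cone_quad xi (cone_pt x r) = xi x * r%:num ^+ 2.
Proof.
rewrite /cone_quad; have [-> h] := cone_ptP x r.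
by have [->|/h->//] := eqVneq r%:num 0; rewrite expr0n/= !mulr0.
Qed.

Lemma cone_sqdistE x1 r1 x2 r2 :
  cone_sqdist (cone_pt x1 r1) (cone_pt x2 r2) =
  r1%:num ^+ 2 + r2%:num ^+ 2
  - 2 * r1%:num * r2%:num * cos (trunc_dist pi x1 x2).
Proof.
rewrite /cone_sqdist; have [-> h1] := cone_ptP x1 r1.
have [-> h2] := cone_ptP x2 r2.
have [->|/h1->] := eqVneq r1%:num 0; first by rewrite !(mulr0, mul0r).
by have [->|/h2->//] := eqVneq r2%:num 0; rewrite !(mulr0, mul0r).
Qed.

(* The infimum in the Hopf-Lax formula is restricted to [A], and the value at
   [t = 0] is [f y] by convention. *)
Definition hopf_lax_on (A : set cone) (t : R) (f : cone -> R) (y : cone) :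
    \bar R :=
  if t == 0 then (f y)%:E else
  ereal_inf [set (f y' + (2 * t)^-1 * cone_sqdist y y')%:E | y' in A].

Definition hopf_lax : R -> (cone -> R) -> cone -> \bar R :=
  hopf_lax_on [set: cone].

Definition evol (t : R) (xi : X -> R) (x : X) : R :=
  if t == 0 then xi x else
  inf [set xi x' / (1 + 2 * t * xi x')
           + sin (trunc_dist (pi / 2) x x') ^+ 2
             / (2 * t * (1 + 2 * t * xi x')) | x' in [set: X]].

End Cone.

(* [f] has right derivative [l] at [t]. *)
Definition is_right_derivative (R : realType) (f : R -> R) (t l : R) : Prop :=
  h^-1 * (f (t + h) - f t) @[h --> (0 : R)^'+] --> l.

(* Main.v *)
Require Import Defs.
From mathcomp Require Import all_boot all_order all_algebra.
From mathcomp Require Import generic_quotient.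
From mathcomp Require Import all_classical all_reals all_analysis.
From mathcomp Require Import ring lra.
Import Order.TTheory GRing.Theory Num.Theory.
Import numFieldNormedType.Exports.
Local Open Scope classical_set_scope.
Local Open Scope ring_scope.

(** Why the theorem holds.

    Write [d] for the distance truncated at [pi / 2], [c x y] for the square
    of [cos (d x y)], and [u] for the weight [(1 + 2 t xi y)^-1].  For a fixed
    base point [y] the Hopf-Lax problem on the cone is a quadratic in the
    radius; completing the square gives the minimum [(1 - c u) r^2 / (2 t)],
    at a radius of at most [r / (1 + 2 t inf xi)].  This is the Hopf-Lax
    formula, with or without a bound on the radius ([hopf_lax_on_evol],
    [best_radius_le]).  Consequently [xi_t x = (1 - S_t x) / (2 t)], where
    [S_t x] is the supremum over [y] of the payoff [c x y * u]
    ([evol_marginal]), and all other claims are read off from [S].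

    In time, each payoff is convex, hence so is [S] ([marginal_convex]): right
    derivatives exist, and all but countably many times are points of
    differentiability.

    Differentiating [xi_t] turns the Hamilton-Jacobi expression into
    [(1/2) (|D xi_t|_a^2 - gap / t^2)], where [gap = t S' + S - S^2]
    ([evol_rateE]); since [2 t |D xi_t| = |D S_t|], the claim is that
    [|D S_t|_a / 2] is at most the square root of [gap].  The link between the
    two sides is the identity [t d/dt (c u) = c u^2 - c u]: for [y] almost
    optimal, [c u] is almost [S], so [gap] is compared with
    [c u^2 - (c u)^2 = (sin (2 d) u / 2)^2], that is, with a quarter of the
    squared derivative of the payoff with respect to the distance.  Because
    the payoffs are convex, their time derivatives at near maximizers are at
    most difference quotients of [S]; so near maximizers at points close to
    [x] have slope at most the square root of [gap], up to any error
    ([near_maximizer_slope2_le]), and this bounds the asymptotic Lipschitz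
    constant ([marginal_local_lip]).  Conversely, near maximizers at a
    slightly later time are near maximizers at time [t] whose slope is almost
    that large ([near_maximizer_slope2_ge]).  In a length space one can move
    from [x] towards such a point along an almost shortest curve, and the
    growth of [S] along the way bounds the slope from below
    ([marginal_slope_ge]).  As the slope never exceeds the asymptotic
    Lipschitz constant, all these quantities then coincide.

    The Lipschitz estimate in time has to be uniform down to [t = 0], where
    [1 / (2 t)] blows up.  Since [xi] is Lipschitz, only points with
    [sin (d x y) <= C t] compete in the infimum ([near_minimizer_close]), and
    for them the cost is Lipschitz in time ([cost_time_lip]). *)

(** * Convex functions on an interval *)

Section ConvexOnInterval.
Context (R : realType) (f : R -> R) (a b : R).

Definition convex_between : Prop := forall s t v : R,
  a < s -> s < t -> t < v -> v < b ->
  (v - s) * f t <= (v - t) * f s + (t - s) * f v.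

Definition diff_quot (t h : R) : R := h^-1 * (f (t + h) - f t).

Context (fcvx : convex_between).

(** The slopes of a convex function increase; the signs of [h] and [k] decide
    which of the three points is the middle one. *)
Lemma diff_quot_le t h k : a < t -> t < b -> a < t + h -> t + k < b ->
  h != 0 -> k != 0 -> h <= k -> diff_quot t h <= diff_quot t k.
Proof.
move=> at_ tb ah kb h0 k0; rewrite le_eqVlt => /predU1P[->//|hk].
rewrite /diff_quot.
have [hp|hn|/eqP] := ltgtP 0 h; last by rewrite eq_sym (negPf h0).
- have kp : 0 < k by apply: lt_trans hk.
  rewrite ler_pdivrMl// mulrA (mulrC h) -mulrA ler_pdivlMl//.
  have := @fcvx t (t + h) (t + k) at_; rewrite ltrDl hp ltrD2l hk.
  by move=> /(_ isT isT kb); lra.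
- have [kp|kn|/eqP] := ltgtP 0 k; last by rewrite eq_sym (negPf k0).
  + rewrite -subr_ge0.
    have := @fcvx (t + h) t (t + k) ah; rewrite gtrDl hn ltrDl kp.
    move=> /(_ isT isT kb) H.
    have -> : k^-1 * (f (t + k) - f t) - h^-1 * (f (t + h) - f t) =
      ((k * - h)^-1) * ((- h) * f (t + k) + k * f (t + h) - (k - h) * f t).
      by field; rewrite h0 k0.
    apply: mulr_ge0; last by lra.
    by rewrite invr_ge0; apply: mulr_ge0; lra.
  + rewrite -subr_ge0.
    have := @fcvx (t + h) (t + k) t ah; rewrite ltrD2l hk gtrDl kn.
    move=> /(_ isT isT tb) H.
    have -> : k^-1 * (f (t + k) - f t) - h^-1 * (f (t + h) - f t) =
      ((- k * - h)^-1) *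
      ((- h) * (f t - f (t + k)) - (- k) * (f t - f (t + h))).
      by field; rewrite h0 k0.
    apply: mulr_ge0; last by lra.
    by rewrite invr_ge0; apply: mulr_ge0; lra.
Qed.

Definition rderiv (t : R) : R := lim (diff_quot t h @[h --> (0 : R)^'+]).
Definition lderiv (t : R) : R := lim (diff_quot t h @[h --> (0 : R)^'-]).

Lemma rderivP t : a < t -> t < b -> is_right_derivative f t (rderiv t).
Proof.
move=> at_ tb; apply: nondecreasing_at_right_is_cvgr.
  near=> x => h k; rewrite !in_itv/= => /andP[h0 hx] /andP[k0 kx] hk.
  apply: diff_quot_le => //; rewrite ?gt_eqF//.
    by rewrite (lt_trans at_)// ltrDl.
  rewrite -ltrBrDl (lt_trans kx)//; near: x.
  by apply: nbhs_right_lt; rewrite subr_gt0.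
near=> x.
exists (diff_quot t (- ((t - a) / 2))) => _ [h]/= + <-.
rewrite in_itv/= => /andP[h0 hx].
have xb : x < b - t by near: x; apply: nbhs_right_lt; rewrite subr_gt0.
apply: diff_quot_le => //; lra.
Unshelve. all: by end_near. Qed.

Lemma rderiv_le t h : a < t -> 0 < h -> t + h < b ->
  rderiv t <= diff_quot t h.
Proof.
move=> at_ h0 hb; have tb : t < b by apply: lt_trans hb; rewrite ltrDl.
have := rderivP _ at_ tb => /cvgP cv.
apply: limr_le => //; near=> k.
have kh : k < h by near: k; exact: nbhs_right_lt.
have k0 : 0 < k by near: k; exact: nbhs_right_gt.
by apply: diff_quot_le => //; rewrite ?gt_eqF//; lra.
Unshelve. all: by end_near. Qed.

Lemma lderivP t : a < t -> t < b ->
  diff_quot t h @[h --> (0 : R)^'-] --> lderiv t.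
Proof.
move=> at_ tb; apply: nondecreasing_at_left_is_cvgr.
  near=> x => h k; rewrite !in_itv/= => /andP[hx h0] /andP[kx k0] hk.
  have xa : a - t < x by near: x; apply: nbhs_left_gt; rewrite subr_lt0.
  by apply: diff_quot_le => //; lra.
near=> x.
exists (diff_quot t ((b - t) / 2)) => _ [h]/= + <-.
rewrite in_itv/= => /andP[hx h0].
have xa : a - t < x by near: x; apply: nbhs_left_gt; rewrite subr_lt0.
apply: diff_quot_le => //; lra.
Unshelve. all: by end_near. Qed.

Lemma lderiv_ge t h : t < b -> h < 0 -> a < t + h ->
  diff_quot t h <= lderiv t.
Proof.
move=> tb h0 ha; have at_ : a < t by apply: (lt_trans ha); rewrite gtrDl.
have := lderivP _ at_ tb => /cvgP cv.
apply: limr_ge => //; near=> k.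
have kh : h < k by near: k; exact: nbhs_left_gt.
have k0 : k < 0 by near: k; exact: nbhs_left_lt.
by apply: diff_quot_le => //; lra.
Unshelve. all: by end_near. Qed.

(** Both one-sided derivatives are compared with the chord over [[s, t]]. *)
Lemma rderiv_le_lderiv s t : a < s -> s < t -> t < b -> rderiv s <= lderiv t.
Proof.
move=> as_ st tb; apply: (@le_trans _ _ (diff_quot s (t - s))).
  by apply: rderiv_le; rewrite ?subr_gt0// subrKC.
have -> : diff_quot s (t - s) = diff_quot t (s - t).
  by rewrite /diff_quot !subrKC; field; lra.
by apply: lderiv_ge => //; rewrite ?subr_lt0// subrKC.
Qed.

Lemma derivable_of_lderiv_ge t : a < t -> t < b -> rderiv t <= lderiv t ->
  derivable f t 1.
Proof.
move=> at_ tb rl.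
have lr : lderiv t <= rderiv t.
  apply: limr_le; first exact: cvgP (lderivP _ at_ tb).
  near=> h.
  have h0 : h < 0 by near: h; exact: nbhs_left_lt.
  have ha : a - t < h by near: h; apply: nbhs_left_gt; rewrite subr_lt0.
  apply: limr_ge; first exact: cvgP (rderivP _ at_ tb).
  near=> k.
  have k0 : 0 < k by near: k; exact: nbhs_right_gt.
  have kb : k < b - t by near: k; apply: nbhs_right_lt; rewrite subr_gt0.
  by apply: diff_quot_le => //; lra.
have e : lderiv t = rderiv t by apply/eqP; rewrite eq_le lr rl.
rewrite /derivable.
have -> : (fun h => h^-1 *: (f (h *: 1 + t) - f t)) = diff_quot t.
  apply/funext => h; rewrite /diff_quot.
  by rewrite -[LHS]/(h^-1 * (f (h * 1 + t) - f t)) mulr1 (addrC h).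
apply: (@cvgP _ _ (rderiv t)); apply: (@cvg_at_right_left_dnbhs _ R^o).
  exact: rderivP.
by rewrite -e; exact: lderivP.
Unshelve. all: by end_near. Qed.

(** At a point of non-differentiability the open interval between the left and
    the right derivative is nonempty, and these intervals are disjoint for
    different points. *)
Lemma convex_countable_not_derivable :
  countable [set t | a < t < b /\ ~ derivable f t 1].
Proof.
(* [setT] is a dummy value: only points with a genuine jump are indexed. *)
pose B t : set R := if lderiv t < rderiv t
  then [set` `]lderiv t, rderiv t[] else setT.
apply: (@separated_open_countable R R B).
- by move=> t; rewrite /B; case: ifPn => _; [exact: itv_open|exact: openT].
- move=> t; rewrite /B; case: ifPn => [lr|_]; last by exists 0.
  by exists ((lderiv t + rderiv t) / 2); rewrite /= in_itv/= !midf_lt.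
- suff H s t : a < s -> s < t -> t < b -> ~ derivable f s 1 ->
      ~ derivable f t 1 -> ~ (B s `&` B t !=set0).
    move=> s t [/andP[as_ sb] ds] [/andP[at_ tb] dt] Bst.
    have [st|ts|//] := ltgtP s t; first by case: (H s t).
    by case: (H t s) => //; rewrite setIC.
  move=> as_ st tb ds dt [x [Bs Bt]].
  have lrP u : a < u -> u < b -> ~ derivable f u 1 -> lderiv u < rderiv u.
    move=> au ub du; rewrite ltNge; apply: contra_notN du.
    exact: derivable_of_lderiv_ge.
  have sb := lt_trans st tb; have at_ := lt_trans as_ st.
  move: Bs Bt; rewrite /B (lrP s as_ sb ds) (lrP t at_ tb dt)/=.
  rewrite !in_itv/= => /andP[_ xs] /andP[tx _].
  have := rderiv_le_lderiv _ _ as_ st tb.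
  by rewrite leNgt (lt_trans tx xs).
Qed.

End ConvexOnInterval.

(** * Elementary inequalities for sine and cosine *)

Section Trigonometry.
Context (R : realType).
Implicit Types a b x y : R.

Lemma mvt_sin x y : x <= y ->
  exists2 c, x <= c <= y & sin y - sin x = cos c * (y - x).
Proof.
move=> xy; have [|c] := @MVT_segment R sin cos x y xy
    (fun z _ => is_derive_sin z).
  by apply: continuous_subspaceT; exact: continuous_sin.
by rewrite in_itv/=; exists c.
Qed.

Lemma mvt_cos x y : x <= y ->
  exists2 c, x <= c <= y & cos y - cos x = - sin c * (y - x).
Proof.
move=> xy; have [|c] := @MVT_segment R cos (fun z => - sin z) x y xy
    (fun z _ => is_derive_cos z).
  by apply: continuous_subspaceT; exact: continuous_cos.
by rewrite in_itv/=; exists c.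
Qed.

Lemma sin_dist_le x y : `|sin x - sin y| <= `|x - y|.
Proof.
wlog yx : x y / y <= x.
  by move=> H; have [/H//|/ltW/H] := leP y x; rewrite distrC (distrC y).
have [c _ ->] := mvt_sin _ _ yx.
by rewrite normrM ler_piMl// cos_max.
Qed.

Lemma cos_sqrB a b : cos a ^+ 2 - cos b ^+ 2 = sin (b - a) * sin (b + a).
Proof.
rewrite sinB sinD -subr_sqr !exprMn !sin2cos2; ring.
Qed.

(** The first-order term [sin (2 a)] is kept, rather than bounded by 1, because
    its size near a maximizer determines the slope of the marginal function. *)
Lemma cos_sqr_dist_le a b :
  `|cos a ^+ 2 - cos b ^+ 2| <= `|a - b| * (`|sin (2 * a)| + `|a - b|).
Proof.
rewrite cos_sqrB normrM ler_pM//.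
  by have := sin_dist_le (b - a) 0; rewrite sin0 !subr0 (distrC b).
have := sin_dist_le (b + a) (2 * a).
have -> : b + a - 2 * a = b - a by ring.
rewrite distrC => h; rewrite (distrC a) -lerBlDl.
by apply: le_trans h; rewrite distrC; exact: lerB_dist.
Qed.

Lemma cos_sqr_lip a b : `|cos a ^+ 2 - cos b ^+ 2| <= `|a - b|.
Proof.
rewrite cos_sqrB normrM -[leRHS]mulr1 ler_pM ?sin_max//.
by have := sin_dist_le (b - a) 0; rewrite sin0 !subr0 (distrC b).
Qed.

Lemma sin_ge_mul_cos x : 0 <= x <= pi -> x * cos x <= sin x.
Proof.
move=> /andP[x0 xpi]; have [c /andP[c0 cx]] := mvt_sin _ _ x0.
rewrite sin0 !subr0 => ->; rewrite mulrC ler_wpM2r//.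
have [->//|cneqx] := eqVneq c x.
apply/ltW; rewrite ltr_cos ?in_itv/= ?c0 ?x0 ?(le_trans cx)//.
by rewrite lt_neqAle cneqx.
Qed.

(** [sin x = 2 sin (x/2) cos (x/2)] is at least [x cos^2 (x/2)], which equals
    [x (1 + cos x) / 2]. *)
Lemma le_double_sin x : 0 <= x <= pi / 2 -> x <= 2 * sin x.
Proof.
move=> /andP[x0 xpi]; have c0 : 0 <= cos x.
  by apply: cos_ge0_pihalf; have := pi_ge0 R; lra.
have hc : 0 <= cos (x / 2).
  apply: cos_ge0_pihalf; have := pi_ge0 R; lra.
have := sin_ge_mul_cos (x / 2) ltac:(have := pi_ge0 R; lra) => hs.
have xE : x = (x / 2) *+ 2 by rewrite mulr2n -splitr.
have sE : sin x = 2 * (cos (x / 2) * sin (x / 2)).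
  by rewrite {1}xE sin_mulr2n mulr_natl.
have cE : cos x = 2 * cos (x / 2) ^+ 2 - 1.
  by rewrite {1}xE cos_mulr2n mulr_natl.
have := ler_wpM2l hc hs.
nra.
Qed.

(** First-order growth of the squared cosine when the distance shrinks by [h],
    with an explicit quadratic error. *)
Lemma cos_sqrB_ge a h : 0 <= h <= 1 ->
  h * sin (2 * a) - 2 * h ^+ 2 <= cos (a - h) ^+ 2 - cos a ^+ 2.
Proof.
move=> /andP[h0 h1]; rewrite cos_sqrB.
have -> : a - (a - h) = h by ring.
have -> : a + (a - h) = 2 * a - h by ring.
have h_pi : 0 <= h <= pi by rewrite h0 (le_trans h1)//; have := pi_ge2 R; lra.
have sge := sin_ge_mul_cos _ h_pi.
have sle : sin h <= h.
  have := sin_dist_le h 0; rewrite sin0 !subr0 (ger0_norm h0).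
  exact: le_trans (ler_norm _).
have cge : 1 - h <= cos h.
  have [c _] := mvt_cos _ _ h0; rewrite cos0 subr0 => e.
  have := sin_le1 c; nra.
have s2 : sin (2 * a) - h <= sin (2 * a - h).
  have := sin_dist_le (2 * a - h) (2 * a).
  have -> : 2 * a - h - 2 * a = - h by ring.
  by rewrite normrN (ger0_norm h0) ler_norml => /andP[]; lra.
have := sin_le1 (2 * a - h).
have hc : h * (1 - h) <= sin h by apply: le_trans sge; rewrite ler_wpM2l.
have := ler_wpM2l h0 s2.
have k0 : 0 <= h - sin h by lra.
move=> e1 e2; have := ler_wpM2l k0 e2; nra.
Qed.

Lemma norm_le_of_sqr_le (a b : R) : 0 <= b -> a ^+ 2 <= b ^+ 2 -> `|a| <= b.
Proof.
by move=> b0; rewrite -(real_normK (num_real a)) ler_sqr// nnegrE normr_ge0.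
Qed.

End Trigonometry.

(** * Truncated distances *)

Section TruncatedDistance.
Context (R : realType) (X : pseudoMetricType R).
Implicit Types (a : R) (x y z : X).

Lemma trunc_distE a x y : 0 <= a ->
  (trunc_dist a x y)%:E = Order.min (edist (x, y)) a%:E.
Proof.
move=> a0; rewrite /trunc_dist fineK// ge0_fin_numE.
  by rewrite gt_min ltry orbT.
by rewrite le_min edist_ge0 lee_fin.
Qed.

Lemma trunc_dist_ge0 a x y : 0 <= a -> 0 <= trunc_dist a x y.
Proof.
by move=> a0; rewrite -lee_fin trunc_distE// le_min edist_ge0 lee_fin.
Qed.

Lemma trunc_dist_le a x y : 0 <= a -> trunc_dist a x y <= a.
Proof. by move=> a0; rewrite -lee_fin trunc_distE// ge_min lexx orbT. Qed.

Lemma trunc_dist_le_edist a x y : 0 <= a ->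
  ((trunc_dist a x y)%:E <= edist (x, y))%E.
Proof. by move=> a0; rewrite trunc_distE// ge_min lexx. Qed.

Lemma trunc_dist_refl a x : 0 <= a -> trunc_dist a x x = 0.
Proof.
by move=> a0; apply: EFin_inj; rewrite trunc_distE// edist_refl min_l// lee_fin.
Qed.

Lemma trunc_dist_sym a x y : trunc_dist a x y = trunc_dist a y x.
Proof. by rewrite /trunc_dist edist_sym. Qed.

Lemma trunc_dist_lt a x y : 0 <= a -> trunc_dist a x y < a ->
  edist (x, y) = (trunc_dist a x y)%:E.
Proof.
by move=> a0; rewrite -lte_fin trunc_distE// gt_min ltxx orbF => /ltW/min_l ->.
Qed.

Lemma trunc_dist_edist_le a x y : 0 <= a -> (edist (x, y) <= a%:E)%E ->
  edist (x, y) = (trunc_dist a x y)%:E.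
Proof. by move=> a0 xya; rewrite trunc_distE// min_l. Qed.

Lemma trunc_dist_triangle a x y z : 0 <= a ->
  trunc_dist a x z <= trunc_dist a x y + trunc_dist a y z.
Proof.
move=> a0.
have [xya|xya] := ltP (trunc_dist a x y) a; last first.
  by rewrite (le_trans (trunc_dist_le _ _ _ a0))// ler_wpDr// trunc_dist_ge0.
have [yza|yza] := ltP (trunc_dist a y z) a; last first.
  by rewrite (le_trans (trunc_dist_le _ _ _ a0))// ler_wpDl// trunc_dist_ge0.
rewrite -lee_fin EFinD -(trunc_dist_lt _ _ _ a0 xya).
rewrite -(trunc_dist_lt _ _ _ a0 yza).
by apply: le_trans (edist_triangle _ _ _); exact: trunc_dist_le_edist.
Qed.

Lemma trunc_dist_dist_le a x y z : 0 <= a ->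
  `|trunc_dist a x z - trunc_dist a y z| <= trunc_dist a x y.
Proof.
move=> a0; rewrite ler_distl; apply/andP; split.
  have := trunc_dist_triangle a y x z a0; rewrite (trunc_dist_sym a y x); lra.
have := trunc_dist_triangle a x y z a0; lra.
Qed.

End TruncatedDistance.

(** * Slopes of a function at a point *)

Section Slopes.
Context (R : realType) (X : pseudoMetricType R) (f : X -> R) (z : X).

Lemma not_isolated_close (rho : R) : ~ isolated [set: X] z -> 0 < rho ->
  exists2 y, y != z & (edist (z, y) < rho%:E)%E.
Proof.
move=> niso rho0; apply: contra_notP niso => noy; split; first by rewrite inE.
exists (ball z (rho / 2)); first by apply: nbhsx_ballx; rewrite divr_gt0.
rewrite setIT; apply/seteqP; split=> [y zy|_ ->]; last first.
  by apply: ballxx; rewrite divr_gt0.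
apply: contra_notP noy => /eqP yz; exists y => //.
have r20 : 0 < rho / 2 by rewrite divr_gt0.
apply: (le_lt_trans (@edist_fin _ _ _ (z, y) r20 zy)).
by rewrite lte_fin ltr_pdivrMr// mulr_natr mulr2n ltrDl.
Qed.

Lemma diff_quotients_le (rho1 rho2 : R) : rho1 <= rho2 ->
  diff_quotients f z rho1 `<=` diff_quotients f z rho2.
Proof.
move=> rr _ [x [y [zx zy xy ->]]]; exists x, y; split=> //.
  by rewrite (lt_le_trans zx)// lee_fin.
by rewrite (lt_le_trans zy)// lee_fin.
Qed.

(** Smaller balls give fewer difference quotients, so their supremum is
    monotone in the radius. *)
Lemma asym_lip_cvg :
  cvg (ereal_sup (diff_quotients f z rho) @[rho --> (0 : R)^'+]).
Proof.
apply: nondecreasing_at_right_is_cvge; near=> x => h k _ _ hk.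
by apply: ereal_sup_le; exact: diff_quotients_le.
Unshelve. all: by end_near. Qed.

Lemma slope_ge0 : (0 <= slope f z)%E.
Proof.
rewrite /slope; case: asboolP => // niso.
apply: limf_esup_ge0 => [|x]; last first.
  by rewrite lee_fin divr_ge0// fine_ge0// edist_ge0.
move=> /nbhs_ballP[e /= e0 h].
have [y yz zy] := not_isolated_close e niso e0.
by have := h y (@edist_lt_ball _ _ _ (z, y) zy) yz.
Qed.

Lemma slope_le_asym_lip : (slope f z <= asym_lip f z)%E.
Proof.
rewrite /slope /asym_lip; case: asboolP => // niso.
apply: lime_ge; first exact: asym_lip_cvg.
near=> rho; have rho0 : 0 < rho by near: rho; exact: nbhs_right_gt.
have r20 : 0 < rho / 2 by rewrite divr_gt0.
apply: (@le_trans _ _ (ereal_sup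
   [set (`|f x - f z| / fine (edist (x, z)))%:E | x in
      [set x | x != z /\ ball z (rho / 2) x]])).
  apply: ereal_inf_lbound.
  exists [set x | x != z /\ ball z (rho / 2) x] => //.
  by apply/nbhs_ballP; exists (rho / 2) => //= y zy yz.
apply: ge_ereal_sup => _ [y [yz zy] <-].
have zyr : (edist (z, y) < rho%:E)%E.
  apply: (le_lt_trans (@edist_fin _ _ _ (z, y) r20 zy)).
  by rewrite lte_fin ltr_pdivrMr// mulr_natr mulr2n ltrDl.
apply: ereal_sup_ubound; exists z, y; split => //.
- by rewrite edist_refl lte_fin.
- by apply/eqP; rewrite eq_sym.
- by rewrite edist_sym.
Unshelve. all: by end_near. Qed.

Lemma asym_lip_le (K : R) : 0 <= K ->
  (forall eta : R, 0 < eta -> exists2 rho : R, 0 < rho & forall x y,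
    (edist (z, x) < rho%:E)%E -> (edist (z, y) < rho%:E)%E ->
    `|f y - f x| <= (K + eta) * fine (edist (x, y))) ->
  (asym_lip f z <= K%:E)%E.
Proof.
move=> K0 h; rewrite /asym_lip; case: asboolP => // niso.
apply/lee_addgt0Pr => eta eta0; have [rho rho0 hr] := h eta eta0.
apply: lime_le; first exact: asym_lip_cvg.
near=> r; have rr : r <= rho by near: r; exact: nbhs_right_le.
apply: ge_ereal_sup => _ [x [y [zx zy xy ->]]].
have xr : (edist (z, x) < rho%:E)%E by rewrite (lt_le_trans zx)// lee_fin.
have yr : (edist (z, y) < rho%:E)%E by rewrite (lt_le_trans zy)// lee_fin.
rewrite -EFinD lee_fin.
have : 0 <= fine (edist (x, y)) by rewrite fine_ge0// edist_ge0.
rewrite le_eqVlt => /predU1P[<-|d0].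
  by rewrite invr0 mulr0 addr_ge0// ltW.
by rewrite ler_pdivrMr// hr.
Unshelve. all: by end_near. Qed.

(** The hypothesis already excludes isolated points, as it provides points at
    arbitrarily small positive distance from [z]. *)
Lemma slope_ge (K : R) :
  (forall eta rho : R, 0 < eta -> 0 < rho -> exists (y : X) (d : R),
    [/\ 0 < d < rho, edist (z, y) = d%:E & (K - eta) * d <= `|f y - f z|]) ->
  (K%:E <= slope f z)%E.
Proof.
move=> h; rewrite /slope; case: asboolP => [[_ [V]]|niso].
  rewrite setIT => /nbhs_ballP[e /= e0 zV] VE.
  have [y [d [/andP[d0 de] zy _]]] := h 1 e ltr01 e0.
  have : V y by apply: zV; apply: (@edist_lt_ball _ _ _ (z, y)); rewrite zy lte_fin.
  rewrite VE => yz; move: zy; rewrite yz edist_refl => -[d00].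
  by rewrite -d00 ltxx in d0.
apply: le_ereal_inf_tmp => _ [A /nbhs_ballP[e /= e0 zA] <-].
apply/lee_addgt0Pr => eta eta0.
have [y [d [/andP[d0 de] zy hy]]] := h eta e eta0 e0.
have yz : y != z.
  apply/eqP => yz; move: zy; rewrite yz edist_refl => -[d00].
  by rewrite -d00 ltxx in d0.
have Ay : A y.
  by apply: zA => //; apply: (@edist_lt_ball _ _ _ (z, y)); rewrite zy lte_fin.
apply: (@le_trans _ _ ((`|f y - f z| / fine (edist (y, z)))%:E + eta%:E)%E).
  rewrite edist_sym zy/= -EFinD lee_fin -lerBlDr ler_pdivlMr//.
by apply: leeD => //; apply: ereal_sup_ubound; exists y.
Unshelve. all: by end_near. Qed.

End Slopes.

(** * Intermediate points in length spaces *)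

Section LengthSpace.
Context (R : realType) (X : pseudoMetricType R).
Local Notation mu := (@lebesgue_measure R).

(** The distance from [x] moves along [g] by at most the increment of the
    continuous function [s |-> \int_0^s m], where [m] is integrable and
    controls [g]. *)
Lemma abs_cont_edist_continuous (g : R -> X) (x : X) : abs_cont_curve g ->
  edist (x, g 0) \is a fin_num ->
  {within `[0, 1], continuous (fun s => fine (edist (x, g s)))}.
Proof.
move=> [m mint gm] x0fin.
pose I s := parameterized_integral mu 0 s m.
have Icont : {within `[0, 1], continuous I}.
  exact: parameterized_integral_continuous.
have gI s t : 0 <= s -> s <= t -> t <= 1 ->
    (edist (g s, g t) <= (I t - I s)%:E)%E.
  move=> s0 st t1; apply: le_trans (gm s t s0 st t1) _.
  have intS a b : 0 <= a -> b <= 1 -> mu.-integrable `[a, b] (EFin \o m).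
    move=> a0 b1; apply: integrableS mint => //.
    by apply: subset_itv; rewrite bnd_simp.
  have intSo : mu.-integrable `]s, t] (EFin \o m).
    apply: integrableS (intS s t s0 t1) => //.
    by apply: subset_itv; rewrite bnd_simp.
  rewrite /I /parameterized_integral Rintegral_itvB ?bnd_simp//; last first.
    exact: intS.
  rewrite Rintegral_itv_obnd_cbnd// /Rintegral fineK//.
  by apply: integrable_fin_num => //; exact: intS.
have xfin s : 0 <= s <= 1 -> edist (x, g s) \is a fin_num.
  move=> /andP[s0 s1]; rewrite ge0_fin_numE ?edist_ge0//.
  apply: le_lt_trans (edist_triangle x (g 0) (g s)) _.
  apply: lte_add_pinfty; first by rewrite -ge0_fin_numE ?edist_ge0.
  by apply: le_lt_trans (gI 0 s _ _ _) (ltry _).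
have psiI s t : 0 <= s -> s <= t -> t <= 1 ->
    `|fine (edist (x, g s)) - fine (edist (x, g t))| <= `|I s - I t|.
  move=> s0 st t1.
  have sfin := xfin s ltac:(lra); have tfin := xfin t ltac:(lra).
  have h1 := edist_triangle x (g s) (g t).
  have h2 := edist_triangle x (g t) (g s).
  have h3 := gI s t s0 st t1.
  have {}h1 := le_trans h1 (leeD (lexx _) h3).
  rewrite (edist_sym (g t)) in h2.
  have {}h2 := le_trans h2 (leeD (lexx _) h3).
  move: h1 h2; rewrite -(fineK sfin) -(fineK tfin) -!EFinD !lee_fin => h1 h2.
  rewrite (distrC (I s)); apply: le_trans (ler_norm _).
  by apply/ler_normlP; split; lra.
apply/subspace_continuousP => s /=; rewrite in_itv/= => s01.
apply/cvgrPdist_lt => e e0.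
have /subspace_continuousP/(_ s) := Icont; rewrite /= in_itv/= => /(_ s01).
move=> /cvgrPdist_lt/(_ e e0) Is.
near=> t.
have t01 : 0 <= t <= 1.
  suff : t \in `[0, 1] by rewrite in_itv.
  by near: t; apply: withinT.
have It : `|I s - I t| < e by near: t.
apply: le_lt_trans It; have [st|ts] := leP s t; first by apply: psiI; lra.
by rewrite distrC (distrC (I s)); apply: psiI; lra.
Unshelve. all: by end_near. Qed.

(** On an almost shortest curve from [x] to [w], the intermediate value theorem
    yields a point at distance [d] from [x]; the length of the curve bounds the
    sum of the distances from that point to the two ends. *)
Lemma length_space_intermediate (x w : X) (a d e : R) : is_length_space X ->
  edist (x, w) = a%:E -> 0 < d < a -> 0 < e ->
  exists2 y, edist (x, y) = d%:E & (edist (y, w) <= (a - d + e)%:E)%E.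
Proof.
move=> len xw /andP[d0 da] e0.
have : (ereal_inf [set curve_length g
      | g in [set g : R -> X | [/\ abs_cont_curve g, g 0%R = x & g 1%R = w]]]
   < (a + e)%:E)%E by rewrite -len xw lte_fin ltrDl.
move=> /ereal_inf_lt[_ [g [acg g0 g1] <-] glen].
have gfin : edist (x, g 0) \is a fin_num by rewrite g0 edist_refl.
have [|s] := IVT (@ler01 R) (abs_cont_edist_continuous g x acg gfin) (v := d).
  by rewrite g0 g1 edist_refl xw/= min_l ?max_r//= ?ltW//; lra.
rewrite in_itv/= => /andP[s0 s1] gsd.
have s0' : 0 < s.
  rewrite lt_neqAle s0 andbT; apply/eqP => s00; move: gsd.
  by rewrite -s00 g0 edist_refl/= => d00; rewrite d00 ltxx in d0.
have s1' : s < 1.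
  rewrite lt_neqAle s1 andbT; apply/eqP => s11; move: gsd.
  by rewrite s11 g1 xw/= => ad; rewrite ad ltxx in da.
have parts : (edist (x, g s) + edist (g s, w) <= curve_length g)%E.
  apply: ereal_sup_ubound; exists [:: s; 1].
    by split; rewrite /= ?s0' ?s1' ?eqxx.
  by rewrite !big_ord_recl big_ord0/= g0 g1 adde0.
have {}parts := le_lt_trans parts glen.
have xs : edist (x, g s) = d%:E.
  rewrite -gsd fineK// ge0_fin_numE ?edist_ge0//.
  apply: le_lt_trans (lt_trans parts (ltry _)).
  by rewrite leeDl// edist_ge0.
exists (g s) => //; move: parts; rewrite xs.
rewrite -lteBrDl// => /ltW; rewrite -EFinB => h.
by apply: le_trans h _; rewrite lee_fin; lra.
Qed.

End LengthSpace.

(** * The marginal function *)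

Section Marginal.
Context (R : realType) (X : pseudoMetricType R) (xi : X -> R).
Implicit Types (s t : R) (x y z : X).

Definition qdist x y : R := trunc_dist (pi / 2) x y.

Definition cos2 x y : R := cos (qdist x y) ^+ 2.

Definition weight t y : R := (1 + 2 * t * xi y)^-1.

Definition payoff t x y : R := cos2 x y * weight t y.

Definition marginal t x : R := sup (range (payoff t x)).

Lemma pihalf_ge0 : 0 <= pi / 2 :> R.
Proof. by rewrite divr_ge0// pi_ge0. Qed.

Lemma qdist_itv x y : 0 <= qdist x y <= pi / 2.
Proof. by rewrite trunc_dist_ge0 ?pihalf_ge0// trunc_dist_le ?pihalf_ge0. Qed.

Lemma qdist_ge0 x y : 0 <= qdist x y.
Proof. by have /andP[] := qdist_itv x y. Qed.

#[local] Hint Resolve pihalf_ge0 qdist_ge0 : core.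

Lemma cos2_ge0 x y : 0 <= cos2 x y. Proof. exact: sqr_ge0. Qed.

Lemma cos2_le1 x y : cos2 x y <= 1.
Proof. by rewrite /cos2 cos2sin2 gerBl sqr_ge0. Qed.

Lemma cos2_refl x : cos2 x x = 1.
Proof.
by rewrite /cos2 /qdist trunc_dist_refl ?pihalf_ge0// cos0 expr1n.
Qed.

Lemma cos2_lip x y z : `|cos2 x z - cos2 y z| <= qdist x y.
Proof.
apply: le_trans (cos_sqr_lip _ _ _) _.
by apply: trunc_dist_dist_le; exact: pihalf_ge0.
Qed.

(** Times range over [[0, T]], and [T] will exceed 1 so that there is room for
    right derivatives at time 1; [m] keeps the denominators away from 0. *)
Context (T m B : R).
Context (m0 : 0 < m).
Context (wm : forall t y, 0 <= t <= T -> m <= 1 + 2 * t * xi y).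
Context (xiB : forall y, `|xi y| <= B).

Lemma weight_gt0 t y : 0 <= t <= T -> 0 < weight t y.
Proof. by move=> tT; rewrite invr_gt0 (lt_le_trans m0)// wm. Qed.

Lemma weight_le t y : 0 <= t <= T -> weight t y <= m^-1.
Proof.
by move=> tT; rewrite lef_pV2 ?posrE ?wm// (lt_le_trans m0)// wm.
Qed.

Lemma weight_mulV t y : 0 <= t <= T -> (1 + 2 * t * xi y) * weight t y = 1.
Proof. by move=> tT; rewrite divff// gt_eqF// (lt_le_trans m0)// wm. Qed.

Lemma weight_diff s t y : 0 <= s <= T -> 0 <= t <= T ->
  weight s y - weight t y = - 2 * xi y * (s - t) * weight s y * weight t y.
Proof.
move=> sT tT; rewrite /weight; field.
by rewrite !gt_eqF// (lt_le_trans m0)// wm.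
Qed.

(** [t |-> (1 + 2 t xi)^-1] is convex, so it lies above its tangents. *)
Lemma weight_tangent s t y : 0 <= s <= T -> 0 <= t <= T ->
  - 2 * xi y * weight t y ^+ 2 * (s - t) <= weight s y - weight t y.
Proof.
move=> sT tT; rewrite weight_diff// -subr_ge0.
have -> : - 2 * xi y * (s - t) * weight s y * weight t y -
    - 2 * xi y * weight t y ^+ 2 * (s - t) =
    - 2 * xi y * (s - t) * weight t y * (weight s y - weight t y) by ring.
rewrite weight_diff//.
have -> : - 2 * xi y * (s - t) * weight t y *
    (- 2 * xi y * (s - t) * weight s y * weight t y) =
    (2 * xi y * (s - t) * weight t y) ^+ 2 * weight s y by ring.
by rewrite mulr_ge0 ?sqr_ge0// ltW// weight_gt0.
Qed.

Lemma payoff_ge0 t x y : 0 <= t <= T -> 0 <= payoff t x y.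
Proof. by move=> tT; rewrite mulr_ge0 ?cos2_ge0// ltW// weight_gt0. Qed.

Lemma payoff_le t x y : 0 <= t <= T -> payoff t x y <= m^-1.
Proof.
move=> tT; rewrite -[leRHS]mul1r ler_pM ?cos2_ge0 ?cos2_le1 ?weight_le//.
by rewrite ltW// weight_gt0.
Qed.

Lemma payoff_ubound t x : 0 <= t <= T -> has_ubound (range (payoff t x)).
Proof. by move=> tT; exists m^-1 => _ [y _ <-]; exact: payoff_le. Qed.

Lemma payoff_le_marginal t x y : 0 <= t <= T -> payoff t x y <= marginal t x.
Proof.
by move=> tT; apply: ub_le_sup; [exact: payoff_ubound|exists y].
Qed.

Lemma marginal_le t x r : (forall y, payoff t x y <= r) -> marginal t x <= r.
Proof.
move=> h; apply: ge_sup; first by exists (payoff t x x), x.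
by move=> _ [y _ <-].
Qed.

Lemma marginal_approx t x (e : R) : 0 <= t <= T -> 0 < e ->
  exists y, marginal t x - e < payoff t x y.
Proof.
move=> tT e0; have [|_ [y _ <-] h] := @sup_adherent _ (range (payoff t x)) e e0.
  by split; [exists (payoff t x x), x|exact: payoff_ubound].
by exists y.
Qed.

Lemma marginal_ge0 t x : 0 <= t <= T -> 0 <= marginal t x.
Proof.
by move=> tT; apply: le_trans (payoff_le_marginal t x x tT); exact: payoff_ge0.
Qed.

Lemma marginal_leV t x : 0 <= t <= T -> marginal t x <= m^-1.
Proof. by move=> tT; apply: marginal_le => y; exact: payoff_le. Qed.

Lemma marginal_lip t x z : 0 <= t <= T ->
  `|marginal t x - marginal t z| <= m^-1 * qdist x z.
Proof.
move=> tT.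
suff H u v : marginal t u <= marginal t v + m^-1 * qdist u v.
  rewrite ler_distl; have := H x z; have := H z x.
  by rewrite /qdist (trunc_dist_sym _ _ _ z x) -/(qdist x z); lra.
apply: marginal_le => y.
have := payoff_le_marginal t v y tT.
suff : payoff t u y - payoff t v y <= m^-1 * qdist u v by lra.
rewrite /payoff -mulrBl mulrC.
have w0 := ltW (weight_gt0 t y tT).
apply: (@le_trans _ _ (weight t y * qdist u v)).
  rewrite ler_wpM2l//; apply: le_trans (cos2_lip u v y); exact: ler_norm.
by rewrite ler_wpM2r ?qdist_ge0// weight_le.
Qed.

(** A supremum of convex functions is convex; convexity of each payoff is read
    off from its tangent at the middle time. *)
Lemma marginal_convex x : convex_between R (marginal ^~ x) 0 T.
Proof.
move=> s t v s0 st tv vT.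
have tT : 0 <= t <= T by lra.
have sT : 0 <= s <= T by lra.
have vT' : 0 <= v <= T by lra.
have vs : 0 < v - s by lra.
rewrite mulrC -ler_pdivlMr//; apply: marginal_le => y.
rewrite ler_pdivlMr//.
have := ler_wpM2l (cos2_ge0 x y) (weight_tangent s t y sT tT).
have := ler_wpM2l (cos2_ge0 x y) (weight_tangent v t y vT' tT).
have := payoff_le_marginal s x y sT.
have := payoff_le_marginal v x y vT'.
rewrite /payoff; set c := cos2 x y; set w := weight t y; set d := xi y * w ^+ 2.
move=> h1 h2 h3 h4.
have vt0 : 0 <= v - t by lra.
have st0 : 0 <= t - s by lra.
have := ler_wpM2l vt0 h2; have := ler_wpM2l st0 h1.
have := ler_wpM2l vt0 h4; have := ler_wpM2l st0 h3.
rewrite /d.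
lra.
Qed.

Lemma evol_marginal t x : 0 < t <= T ->
  evol t xi x = (2 * t)^-1 * (1 - marginal t x).
Proof.
move=> /andP[t0 tT]; have tT' : 0 <= t <= T by rewrite ltW.
rewrite /evol gt_eqF//.
have -> : [set xi x' / (1 + 2 * t * xi x')
           + sin (trunc_dist (pi / 2) x x') ^+ 2
             / (2 * t * (1 + 2 * t * xi x')) | x' in [set: X]] =
   [set (2 * t)^-1 * (1 - payoff t x y) | y in [set: X]].
  apply: eq_imagel => y _; rewrite /payoff /cos2 cos2sin2 /weight /qdist.
  by field; rewrite !gt_eqF// (lt_le_trans m0)// wm.
have t20 : 0 < 2 * t by rewrite mulr_gt0.
apply/eqP; rewrite eq_le; apply/andP; split.
  rewrite ler_pdivlMl// lerBrDl; apply/ler_addgt0Pr => e e0.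
  have [y hy] := marginal_approx t x e tT' e0.
  have : inf [set (2 * t)^-1 * (1 - payoff t x y) | y in [set: X]] <=
      (2 * t)^-1 * (1 - payoff t x y).
    apply: ge_inf; last by exists y.
    exists ((2 * t)^-1 * (1 - m^-1)) => _ [z _ <-].
    by rewrite ler_pM2l ?invr_gt0// lerD2l lerN2 payoff_le.
  by rewrite ler_pdivlMl//; lra.
apply: lb_le_inf; first by exists ((2 * t)^-1 * (1 - payoff t x x)), x.
move=> _ [y _ <-]; rewrite ler_pM2l ?invr_gt0// lerD2l lerN2.
exact: payoff_le_marginal.
Qed.

(** * The Hamilton-Jacobi expression and near maximizers *)

Definition speed t x : R := rderiv R (marginal ^~ x) t.

(** The amount by which [- (d/dt) xi_t] exceeds [2 xi_t ^ 2], multiplied by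
    [2 t ^ 2]; see [evol_rateE]. *)
Definition gap t x : R := t * speed t x + marginal t x - marginal t x ^+ 2.

(** A quarter of the squared derivative of the payoff with respect to the
    distance between [x] and [y]; see [slope2E]. *)
Definition slope2 t x y : R := cos2 x y * weight t y ^+ 2 - payoff t x y ^+ 2.

Lemma slope2E t x y : slope2 t x y = (sin (2 * qdist x y) * weight t y / 2) ^+ 2.
Proof.
rewrite mulr_natl sin_mulr2n -mulr_natl.
transitivity (cos2 x y * sin (qdist x y) ^+ 2 * weight t y ^+ 2).
  by rewrite sin2cos2 /slope2 /payoff /cos2; ring.
by rewrite /cos2; field.
Qed.

Lemma payoff_tangent t x y : 0 <= t <= T ->
  t * (cos2 x y * (- 2 * xi y * weight t y ^+ 2)) =
  cos2 x y * weight t y ^+ 2 - payoff t x y.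
Proof.
move=> tT; have e := weight_mulV t y tT.
have -> : t * (cos2 x y * (- 2 * xi y * weight t y ^+ 2)) =
  cos2 x y * weight t y ^+ 2 -
  cos2 x y * weight t y * ((1 + 2 * t * xi y) * weight t y) by ring.
by rewrite e mulr1.
Qed.

(** By convexity the time derivative [phi'] of the payoff of a near maximizer
    [y] at [z] satisfies [h phi' <= S_{t+h} z - S_t z + e].  For a fixed small
    [h] the right-hand side is close to [S_{t+h} x - S_t x], hence to
    [h (d/dt) S_t x], once [e] and the distance from [z] to [x] are small
    compared with [h]. *)
Lemma near_maximizer_slope2_le t x (eta : R) : 0 < t < T -> 0 < eta ->
  exists2 e : R, 0 < e & forall y z, qdist x z < e ->
    marginal t z - e < payoff t z y -> slope2 t z y <= gap t x + eta.
Proof.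
move=> /andP[t0 tT] eta0; have tT' : 0 <= t <= T by lra.
have [h [h0 hT hq]] : exists h : R, [/\ 0 < h, t + h < T &
    t * diff_quot R (marginal ^~ x) t h <= t * speed t x + eta / 2].
  have := rderivP R _ 0 T (marginal_convex x) t t0 tT.
  rewrite /is_right_derivative => /cvgrPdist_le /(_ (eta / (2 * t))) H.
  have : 0 < eta / (2 * t) by rewrite divr_gt0// mulr_gt0.
  move=> {}/H H; near (0:R)^'+ => h; exists h.
  split; first by near: h; exact: nbhs_right_gt.
    rewrite -ltrBrDl; near: h; apply: nbhs_right_lt; lra.
  have : `|speed t x - diff_quot R (marginal ^~ x) t h| <= eta / (2 * t).
    by near: h.
  rewrite distrC => /ler_normlW; rewrite lerBlDr => /(ler_wpM2l (ltW t0)).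
  suff -> : t * (eta / (2 * t) + speed t x) = t * speed t x + eta / 2 by [].
  by field; rewrite gt_eqF.
have thT : 0 <= t + h <= T by lra.
pose C := m^-1; have C0 : 0 < C by rewrite invr_gt0.
(* The two terms of [K] collect the errors in [t phi'] and in
   [payoff - payoff ^ 2]. *)
pose K := t * (2 * C + 1) / h + (1 + C) * (1 + 2 * C).
have K0 : 0 < K.
  by rewrite addr_gt0// ?divr_gt0 ?mulr_gt0 ?addr_gt0// mulr_gt0.
exists (eta / 2 / K); first by rewrite !divr_gt0.
set e := eta / 2 / K; move=> y z xz hy.
have e0 : 0 < e by rewrite !divr_gt0.
have Ke : K * e = eta / 2 by rewrite /e; field; rewrite gt_eqF.
have Ce : C * qdist x z <= C * e by rewrite ler_pM2l// ltW.
have /ler_normlP[m1 m2] := le_trans (marginal_lip t x z tT') Ce.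
have /ler_normlP[m3 m4] := le_trans (marginal_lip (t + h) x z thT) Ce.
have p1 := payoff_le_marginal t z y tT'.
have p2 := payoff_le_marginal (t + h) z y thT.
have p3 := payoff_ge0 t z y tT'.
have p4 : payoff t z y <= C := payoff_le t z y tT'.
have p5 := marginal_ge0 t x tT'.
have p6 : marginal t x <= C := marginal_leV t x tT'.
have tg := ler_wpM2l (cos2_ge0 z y) (weight_tangent (t + h) t y thT tT').
have dq : h * diff_quot R (marginal ^~ x) t h =
    marginal (t + h) x - marginal t x.
  by rewrite /diff_quot mulrA divff ?mul1r// gt_eqF.
set phi' := cos2 z y * (- 2 * xi y * weight t y ^+ 2).
have hphi : h * phi' <= h * diff_quot R (marginal ^~ x) t h + (2 * C + 1) * e.
  rewrite dq; move: tg.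
  have -> : t + h - t = h by ring.
  rewrite mulrBr -/(payoff (t + h) z y) -/(payoff t z y).
  have -> : cos2 z y * (- 2 * xi y * weight t y ^+ 2 * h) = h * phi'.
    by rewrite /phi'; ring.
  lra.
have phiq : t * phi' <= t * diff_quot R (marginal ^~ x) t h +
    t * (2 * C + 1) / h * e.
  have -> : t * diff_quot R (marginal ^~ x) t h + t * (2 * C + 1) / h * e =
    t / h * (h * diff_quot R (marginal ^~ x) t h + (2 * C + 1) * e).
    by field; rewrite gt_eqF.
  have -> : t * phi' = t / h * (h * phi') by field; rewrite gt_eqF.
  by rewrite ler_wpM2l// divr_ge0// ltW.
have quad : payoff t z y - payoff t z y ^+ 2 <=
    marginal t x - marginal t x ^+ 2 + (1 + C) * (1 + 2 * C) * e.
  set p := payoff t z y in p1 p3 p4 hy *; set S := marginal t x in p5 p6 m1 m2 *.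
  have d1 : `|p - S| <= (1 + C) * e.
    by apply/ler_normlP; split; lra.
  have d2 : `|1 - p - S| <= 1 + 2 * C by apply/ler_normlP; split; lra.
  have := ler_pM (normr_ge0 _) (normr_ge0 _) d1 d2; rewrite -normrM.
  by move/ler_normlW; lra.
have := payoff_tangent t z y tT'; rewrite -/phi' /slope2 /gap => e1.
have : K * e = t * (2 * C + 1) / h * e + (1 + C) * (1 + 2 * C) * e.
  by rewrite /K; ring.
lra.
Unshelve. all: by end_near. Qed.

Lemma gap_ge0 t x : 0 < t < T -> 0 <= gap t x.
Proof.
move=> tT; apply/ler_addgt0Pr => eta eta0.
have [e e0 h] := near_maximizer_slope2_le t x eta tT eta0.
have tT' : 0 <= t <= T by lra.
have [y hy] := marginal_approx t x e tT' e0.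
apply: le_trans (h y x _ hy); first by rewrite slope2E sqr_ge0.
by rewrite /qdist trunc_dist_refl// pihalf_ge0.
Qed.

(** A maximizer at time [t + h], up to [h ^ 2], almost maximizes at time [t]
    too, and there the time derivative of its payoff is at least that of the
    marginal function, up to [O(h)]. *)
Lemma near_maximizer_slope2_ge t x (eta : R) : 0 < t < T -> 0 < eta ->
  exists y, marginal t x - eta < payoff t x y /\ gap t x - eta <= slope2 t x y.
Proof.
move=> /andP[t0 tT] eta0; have tT' : 0 <= t <= T by lra.
pose C := m^-1; have C0 : 0 < C by rewrite invr_gt0.
have B0 : 0 <= B by apply: le_trans (xiB x).
(* [L] is the Lipschitz constant of the payoffs in time, and [M] bounds the
   second-order term of their Taylor expansion. *)
pose L := 2 * B * C ^+ 2.
have L0 : 0 <= L by rewrite !mulr_ge0 ?exprn_ge0// ltW.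
pose M := 4 * B ^+ 2 * C ^+ 3.
have M0 : 0 <= M by rewrite !mulr_ge0 ?exprn_ge0// ltW.
pose K := t * (M + 1) + (1 + 2 * C) * (1 + 2 * L) + 2.
have K0 : 0 < K.
  have k1 : 0 <= t * (M + 1) by rewrite mulr_ge0 ?addr_ge0// ltW.
  have k2 : 0 <= (1 + 2 * C) * (1 + 2 * L).
    by rewrite mulr_ge0 ?addr_ge0 ?mulr_ge0// ltW.
  by rewrite /K; lra.
pose h := Num.min (Num.min 1 ((T - t) / 2)) (eta / K).
have h0 : 0 < h by rewrite !lt_min ltr01 !divr_gt0//= subr_gt0.
have h1 : h <= 1 by rewrite !ge_min lexx.
have hT : h <= (T - t) / 2 by rewrite !ge_min lexx orbT.
have hK : K * h <= eta.
  by rewrite mulrC -ler_pdivlMr// !ge_min lexx orbT.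
have thT : 0 <= t + h <= T by lra.
have hh0 : 0 < h ^+ 2 by rewrite exprn_gt0.
have [y hy] := marginal_approx (t + h) x (h ^+ 2) thT hh0.
exists y.
have hh : h ^+ 2 <= h by rewrite expr2 ler_piMl// ltW.
have wlip z : `|payoff (t + h) x z - payoff t x z| <= L * h.
  rewrite /payoff -mulrBr weight_diff// normrM -[leRHS]mul1r.
  rewrite ler_pM ?normr_ge0//; first by rewrite ger0_norm ?cos2_ge0 ?cos2_le1.
  have -> : t + h - t = h by ring.
  rewrite !normrM normrN (ger0_norm (ltW (weight_gt0 (t + h) z thT))).
  rewrite (ger0_norm (ltW (weight_gt0 t z tT'))) (gtr0_norm h0).
  rewrite (ger0_norm (ler0n R 2)).
  have -> : 2 * `|xi z| * h * weight (t + h) z * weight t z =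
    (2 * h) * (`|xi z| * (weight (t + h) z * weight t z)) by ring.
  have -> : L * h = (2 * h) * (B * (C * C)) by rewrite /L; ring.
  have w1 := weight_gt0 (t + h) z thT.
  have w2 := weight_gt0 t z tT'.
  apply: ler_wpM2l; first by rewrite mulr_ge0// ltW.
  apply: ler_pM => //; first by rewrite mulr_ge0// ltW.
  by apply: ler_pM; rewrite ?weight_le// ltW.
have mono : marginal t x <= marginal (t + h) x + L * h.
  apply: marginal_le => z; have /ler_normlP[] := wlip z.
  by have := payoff_le_marginal (t + h) x z thT; lra.
have /ler_normlP[l1 l2] := wlip y.
have Kge : t * (M + 1) * h + (1 + 2 * C) * (1 + 2 * L) * h + 2 * h <= eta.
  by apply: le_trans hK; rewrite /K; lra.
have tMh : 0 <= t * (M + 1) * h by rewrite !mulr_ge0 ?addr_ge0// ltW.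
have LC : (1 + 2 * L) * h <= (1 + 2 * C) * (1 + 2 * L) * h.
  have : 0 <= 2 * C * ((1 + 2 * L) * h).
    apply: mulr_ge0; first by rewrite mulr_ge0// ltW.
    by rewrite mulr_ge0 ?addr_ge0 ?mulr_ge0// ltW.
  lra.
split; first lra.
set phi' := cos2 x y * (- 2 * xi y * weight t y ^+ 2).
have taylor : payoff (t + h) x y - payoff t x y <= h * phi' + M * h ^+ 2.
  have -> : payoff (t + h) x y - payoff t x y = h * phi' + h ^+ 2 *
    (4 * (xi y ^+ 2 * (cos2 x y * (weight t y ^+ 2 * weight (t + h) y)))).
    have e0 : weight (t + h) y - weight t y +
        2 * xi y * h * weight (t + h) y * weight t y = 0.
      by rewrite weight_diff//; ring.
    apply: subr0_eq.
    transitivity (cos2 x y * (1 - 2 * h * xi y * weight t y) *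
        (weight (t + h) y - weight t y +
         2 * xi y * h * weight (t + h) y * weight t y)).
      by rewrite /phi' /payoff; ring.
    by rewrite e0 mulr0.
  rewrite lerD2l mulrC ler_wpM2r ?sqr_ge0// /M -mulrA ler_wpM2l//.
  have w1 := ltW (weight_gt0 (t + h) y thT).
  have w2 := ltW (weight_gt0 t y tT').
  have w20 : 0 <= weight t y ^+ 2 by rewrite sqr_ge0.
  apply: ler_pM; rewrite ?sqr_ge0//.
  - by rewrite mulr_ge0 ?cos2_ge0// mulr_ge0.
  - by rewrite -[leLHS]real_normK ?num_real// lerXn2r ?nnegrE ?xiB.
  - rewrite -[leRHS]mul1r; apply: ler_pM; rewrite ?cos2_ge0 ?cos2_le1//.
      by rewrite mulr_ge0.
    rewrite (exprSr C 2); apply: ler_pM; rewrite ?weight_le//.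
    by rewrite lerXn2r ?nnegrE ?weight_le// ltW.
have thT' : t + h < T by lra.
have rd := rderiv_le R _ 0 T (marginal_convex x) t h t0 h0 thT'.
have p1 := payoff_le_marginal t x y tT'.
have sp : h * speed t x <= h * (phi' + (M + 1) * h).
  apply: (@le_trans _ _ (marginal (t + h) x - marginal t x)).
    have := ler_wpM2l (ltW h0) rd; rewrite /diff_quot mulrA divff ?mul1r//.
    by rewrite gt_eqF.
  lra.
move: sp; rewrite ler_pM2l// => /(ler_wpM2l (ltW t0)) sp.
have e1 := payoff_tangent t x y tT'; rewrite -/phi' in e1.
have p3 := payoff_ge0 t x y tT'.
have p4 : payoff t x y <= C := payoff_le t x y tT'.
have p5 := marginal_ge0 t x tT'.
have p6 : marginal t x <= C := marginal_leV t x tT'.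
have quad : marginal t x - marginal t x ^+ 2 <=
    payoff t x y - payoff t x y ^+ 2 + (1 + 2 * C) * (1 + 2 * L) * h.
  set p := payoff t x y in p1 p3 p4 hy l1 l2 *; set S := marginal t x in p5 p6 mono p1 *.
  have d1 : `|S - p| <= (1 + 2 * L) * h.
    by apply/ler_normlP; split; lra.
  have d2 : `|1 - p - S| <= 1 + 2 * C by apply/ler_normlP; split; lra.
  have := ler_pM (normr_ge0 _) (normr_ge0 _) d2 d1; rewrite -normrM.
  by move/ler_normlW; lra.
rewrite /gap /slope2; lra.
Qed.

(** * Spatial slopes of the marginal function *)

(** Replacing [y] by [z] changes the payoff of a near maximizer at [y] by at
    most [qdist y z] times its slope, up to second order, and near maximizers
    at points close to [x] have slope at most [2 sqrt gap]. *)
Lemma marginal_local_lip t x (kappa eta : R) : 0 < t < T -> 0 <= kappa ->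
  gap t x <= kappa ^+ 2 -> 0 < eta ->
  exists2 rho : R, 0 < rho & forall y z, qdist x y < rho -> qdist x z < rho ->
    `|marginal t y - marginal t z| <= 2 * (kappa + eta) * qdist y z.
Proof.
move=> tT k0 gk eta0; have tT' : 0 <= t <= T by lra.
have eta40 : 0 < eta ^+ 2 / 4 by rewrite divr_gt0// exprn_gt0.
have [e e0 near_max] := near_maximizer_slope2_le t x _ tT eta40.
have em0 : 0 < eta * m / 2 by rewrite divr_gt0// mulr_gt0.
exists (Num.min e (eta * m / 2)); first by rewrite lt_min e0.
suff H y z : qdist x y < Num.min e (eta * m / 2) ->
    qdist x z < Num.min e (eta * m / 2) ->
    marginal t y <= marginal t z + 2 * (kappa + eta) * qdist y z.
  move=> y z xy xz; rewrite ler_distl.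
  have := H y z xy xz; have := H z y xz xy.
  by rewrite /qdist (trunc_dist_sym _ _ _ z y); lra.
rewrite !lt_min => /andP[xy xy'] /andP[xz xz'].
apply/ler_addgt0Pr => e' e'0.
have ee0 : 0 < Num.min e e' by rewrite lt_min e0.
have [w hw] := marginal_approx t y _ tT' ee0.
have le1 : Num.min e e' <= e by rewrite ge_min lexx.
have le2 : Num.min e e' <= e' by rewrite ge_min lexx orbT.
have := near_max w y xy ltac:(lra).
rewrite slope2E => h1.
have h2 : `|sin (2 * qdist y w) * weight t w / 2| <= kappa + eta / 2.
  apply: norm_le_of_sqr_le; first by rewrite addr_ge0// divr_ge0// ltW.
  apply: le_trans h1 _.
  have : 0 <= kappa * eta by rewrite mulr_ge0// ltW.
  lra.
have w0 := weight_gt0 t w tT'; have wV := weight_le t w tT'.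
move: h2; rewrite normrM (gtr0_norm (_ : 0 < 2^-1)) ?invr_gt0//.
rewrite normrM (gtr0_norm w0) => h2.
have d0 := qdist_ge0 y z.
have dd : `|qdist y w - qdist z w| <= qdist y z.
  exact: trunc_dist_dist_le.
have := cos_sqr_dist_le _ (qdist y w) (qdist z w).
move=> /(le_trans (ler_norm _)) h3.
have {}h3 : cos2 y w - cos2 z w <=
    qdist y z * (`|sin (2 * qdist y w)| + qdist y z).
  by apply: le_trans h3 _; apply: ler_pM => //; rewrite ?addr_ge0// lerD2l.
have := ler_wpM2r (ltW w0) h3; rewrite mulrBl -/(payoff _ _ _) -/(payoff _ _ _).
have p1 := payoff_le_marginal t z w tT'.
have dsmall : qdist y z * weight t w <= eta.
  have : qdist y z <= eta * m.
    apply: le_trans (trunc_dist_triangle _ _ _ y x z pihalf_ge0) _.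
    by rewrite trunc_dist_sym; rewrite /qdist in xy' xz'; lra.
  move=> dle; apply: (@le_trans _ _ (eta * m * m^-1)).
    by apply: ler_pM => //; exact: ltW.
  by rewrite -mulrA divff ?mulr1// gt_eqF.
rewrite /payoff in hw p1 *.
have := ler_wpM2l d0 dsmall; have := ler_wpM2l d0 h2.
lra.
Qed.

(** Take a near maximizer [w] with slope almost [2 sqrt gap], and a point [y] at
    distance [d] from [x] on an almost shortest curve towards [w].  The payoff
    of [w] grows by [d] times its slope from [x] to [y]; the errors, in
    particular the defect in maximality of [w], are of order [d ^ 2]. *)
Lemma marginal_slope_ge t x (kappa eta rho : R) : is_length_space X ->
  0 < t < T -> 0 < kappa -> kappa ^+ 2 <= gap t x -> 0 < eta -> 0 < rho ->
  exists y (d : R), [/\ 0 < d < rho, edist (x, y) = d%:E &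
    2 * (kappa - eta) * d <= marginal t y - marginal t x].
Proof.
move=> len tT k0 kg eta0 rho0; have tT' : 0 <= t <= T by lra.
pose eta1 := Num.min (kappa / 2) (eta / 2).
have e1k : eta1 <= kappa / 2 by rewrite ge_min lexx.
have e1e : eta1 <= eta / 2 by rewrite ge_min lexx orbT.
have e10 : 0 < eta1 by rewrite lt_min !divr_gt0.
pose K := 2 * kappa + 2 / m + 1.
have K0 : 0 < K by rewrite !addr_gt0 ?divr_gt0 ?mulr_gt0.
(* [kappa * m / 4] keeps [d] below the distance from [x] to [w], which is at
   least [kappa * m / 2] because the slope at [w] is not small. *)
pose d := Num.min (Num.min (1 / 2) (rho / 2))
  (Num.min (kappa * m / 4) (2 * eta1 / K)).
have d0 : 0 < d by rewrite !lt_min !divr_gt0 ?mulr_gt0.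
have d1 : d <= 1 / 2 by rewrite !ge_min lexx.
have dr : d <= rho / 2 by rewrite !ge_min lexx !orbT.
have dk : d <= kappa * m / 4 by rewrite !ge_min lexx !orbT.
have dK : K * d <= 2 * eta1.
  by rewrite mulrC -ler_pdivlMr// !ge_min lexx !orbT.
pose e := Num.min (d ^+ 2) (kappa * eta1).
have e0 : 0 < e by rewrite lt_min exprn_gt0// mulr_gt0.
have ed : e <= d ^+ 2 by rewrite ge_min lexx.
have ek : e <= kappa * eta1 by rewrite ge_min lexx orbT.
have [w [hw hs]] := near_maximizer_slope2_ge t x e tT e0.
set a := qdist x w.
have /andP[a0 api] : 0 <= a <= pi / 2 := qdist_itv x w.
have w0 := weight_gt0 t w tT'; have wV := weight_le t w tT'.
have s0 : 0 <= sin (2 * a).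
  by apply: sin_ge0_pi; rewrite mulr_ge0//=; lra.
have hsin : kappa - eta1 <= sin (2 * a) * weight t w / 2.
  rewrite -ler_sqr ?nnegrE; last 2 first.
  - lra.
  - by rewrite !mulr_ge0// ltW.
  rewrite -slope2E; apply: le_trans hs.
  have := ler_wpM2l (ltW e10) e1k.
  lra.
have sinm : kappa * m <= sin (2 * a).
  have : kappa <= sin (2 * a) * m^-1.
    apply: (@le_trans _ _ (sin (2 * a) * weight t w)); first lra.
    by rewrite ler_wpM2l.
  by rewrite ler_pdivlMr.
have km0 : 0 < kappa * m by rewrite mulr_gt0.
have apos : kappa * m <= 2 * a.
  apply: le_trans sinm _.
  have := sin_dist_le R (2 * a) 0; rewrite sin0 !subr0.
  by rewrite (ger0_norm (mulr_ge0 _ a0))//; exact: le_trans (ler_norm _).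
have alt : a < pi / 2.
  rewrite lt_neqAle api andbT; apply/eqP => apiE; move: sinm.
  rewrite apiE; have -> : 2 * (pi / 2) = pi :> R by field.
  by rewrite sinpi leNgt km0.
have xw : edist (x, w) = a%:E by apply: trunc_dist_lt.
have da : 0 < d < a by apply/andP; split => //; lra.
have dd0 : 0 < d ^+ 2 by rewrite exprn_gt0.
have [y xy yw] := length_space_intermediate R X x w a d _ len xw da dd0.
exists y, d; split => //; first by rewrite d0; lra.
set h := d - d ^+ 2.
have dd : d ^+ 2 <= d / 2.
  by rewrite expr2 ler_pM2l//; lra.
have h01 : 0 <= h <= 1 by rewrite /h; lra.
have yw' : qdist y w <= a - h.
  rewrite -lee_fin; apply: le_trans (trunc_dist_le_edist _ _ _ _ _ _) _ => //.
  by apply: le_trans yw _; rewrite lee_fin /h; lra.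
have pi0 := pi_ge0 R.
have cosle : cos (a - h) ^+ 2 <= cos2 y w.
  have /andP[q0 qpi] := qdist_itv y w.
  rewrite /cos2 lerXn2r ?nnegrE//.
  - by apply: cos_ge0_pihalf; lra.
  - by apply: cos_ge0_pihalf; lra.
  - have [->//|neq] := eqVneq (qdist y w) (a - h).
    apply: ltW; rewrite ltr_cos ?in_itv/=; [|lra|lra].
    by rewrite lt_neqAle neq.
have := cos_sqrB_ge _ a h h01.
have -> : cos a ^+ 2 = cos2 x w by [].
move=> cge.
have := ler_wpM2r (ltW w0) (le_trans cge (lerB cosle (lexx (cos2 x w)))).
rewrite !mulrBl -/(payoff t y w) -/(payoff t x w) => pge.
have p1 := payoff_le_marginal t y w tT'.
have h0 : 0 <= h by lra.
have := ler_wpM2l h0 hsin.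
have hh : h ^+ 2 <= d ^+ 2 by rewrite lerXn2r ?nnegrE /h//; lra.
have : 2 * h ^+ 2 * weight t w <= 2 * d ^+ 2 * m^-1.
  apply: ler_pM => //; [|exact: ltW|by rewrite ler_wpM2l].
  by rewrite mulr_ge0// sqr_ge0.
have := ler_wpM2l (ltW d0) dK.
have e2 : 0 <= eta1 * d ^+ 2 by rewrite mulr_ge0// ltW.
have e3 : 2 * (kappa - eta) * d <= 2 * (kappa - 2 * eta1) * d.
  by rewrite ler_pM2r// ler_pM2l//; lra.
rewrite /K /h in pge *; lra.
Qed.

(** * Derivatives of the evolution *)

Definition evol_rate t x : R :=
  - (2 * t)^-1 * speed t x - (2 * t ^+ 2)^-1 * (1 - marginal t x).

Lemma evol_right_derivative t x : 0 < t < T ->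
  is_right_derivative (fun s => evol s xi x) t (evol_rate t x).
Proof.
move=> /andP[t0 tT].
have rd := rderivP R _ 0 T (marginal_convex x) t t0 tT.
rewrite /is_right_derivative in rd *.
have tnear : (fun h : R => t + h) h @[h --> (0:R)^'+] --> t.
  rewrite -[X in _ --> X]addr0; apply: cvgD; first exact: cvg_cst.
  exact: cvg_at_right_filter.
suff : (- (2 * (t + h))^-1 * diff_quot R (marginal ^~ x) t h -
    (2 * t * (t + h))^-1 * (1 - marginal t x)) @[h --> (0:R)^'+]
    --> evol_rate t x.
  apply: cvg_trans; apply: near_eq_cvg; near=> h.
  have h0 : 0 < h by near: h; exact: nbhs_right_gt.
  have hT : h < T - t by near: h; apply: nbhs_right_lt; lra.
  rewrite !evol_marginal ?t0/=; [|lra|lra].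
  rewrite /diff_quot; field; rewrite !gt_eqF//; lra.
rewrite /evol_rate.
apply: cvgB; last first.
  apply: cvgMl; rewrite expr2 mulrA.
  apply: cvgV; first by rewrite !mulf_neq0 ?gt_eqF.
  by apply: cvgMr.
apply: cvgM => //; apply: cvgN; apply: cvgV; first by rewrite mulf_neq0 ?gt_eqF.
by apply: cvgMr.
Unshelve. all: by end_near. Qed.

(** Multiplied by [2 t ^ 2], both sides become [- t S' - S + S ^ 2]. *)
Lemma evol_rateE t x : 0 < t <= T ->
  evol_rate t x + 2 * evol t xi x ^+ 2 = - (1 / 2) * (gap t x / t ^+ 2).
Proof.
move=> tT; rewrite evol_marginal// /evol_rate /gap; field.
by rewrite gt_eqF//; lra.
Qed.

(** Time 0 is counted among the exceptions, as [evol] has no meaning for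
    negative times. *)
Lemma evol_countable_not_derivable x :
  countable [set t | 0 <= t < T /\ ~ derivable (fun s => evol s xi x) t 1].
Proof.
pose F (b : bool) : set R := if b then [set 0] else
   [set t | 0 < t < T /\ ~ derivable (marginal ^~ x) t 1].
apply: (@sub_countable _ _ _ (\bigcup_b F b)); last first.
  apply: bigcup_countable => [|[] _]; [exact: countableP|exact: countable1|].
  exact: (convex_countable_not_derivable R _ 0 T (marginal_convex x)).
apply: subset_card_le => t [/andP[t0 tT] ndt].
have [->|tn0] := eqVneq t 0; first by exists true.
exists false; first exact: I.
have {}t0 : 0 < t by rewrite lt_neqAle eq_sym tn0.
split; first by rewrite t0.
move=> dt; apply: ndt.
have : derivable (fun s => (2 * s)^-1 * (1 - marginal s x)) t 1.
  apply: derivableM; last by apply: derivableB; [exact: derivable_cst|].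
  apply: derivableV; first by rewrite mulf_neq0// gt_eqF.
  by apply: derivableM; [exact: derivable_cst|exact: derivable_id].
apply: near_eq_derivable.
near=> s; rewrite evol_marginal//.
have s0 : 0 < s by near: s; exact: lt_nbhsr.
have sT : s < T by near: s; exact: lt_nbhsl.
by rewrite s0 ltW.
Unshelve. all: by end_near. Qed.

Lemma evol_diff t x y : 0 < t <= T ->
  evol t xi y - evol t xi x = (2 * t)^-1 * (marginal t x - marginal t y).
Proof. by move=> tT; rewrite !evol_marginal//; ring. Qed.

Lemma evol_asym_lip_le t x : 0 < t < T ->
  (asym_lip (evol t xi) x <= (Num.sqrt (gap t x) / t)%:E)%E.
Proof.
move=> tT; have [t0 tT'] : 0 < t /\ 0 < t <= T by lra.
have g0 := gap_ge0 t x tT; have s0 := sqrtr_ge0 (gap t x).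
apply: asym_lip_le => [|eta eta0]; first by rewrite divr_ge0// ltW.
have et0 : 0 < eta * t by rewrite mulr_gt0.
have gk : gap t x <= Num.sqrt (gap t x) ^+ 2 by rewrite sqr_sqrtr.
have [rho rho0 h] := marginal_local_lip t x _ _ tT s0 gk et0.
have pi0 : 0 < pi / 2 :> R by rewrite divr_gt0// pi_gt0.
exists (Num.min rho (pi / 4)).
  by rewrite lt_min rho0 divr_gt0// pi_gt0.
move=> y z xy xz.
have near_qdist u :
    (edist (x, u) < (Num.min rho (pi / 4))%:E)%E -> qdist x u < rho.
  move=> xu; rewrite -lte_fin.
  apply: le_lt_trans (trunc_dist_le_edist _ _ _ _ _ _) _ => //.
  by apply: lt_le_trans xu _; rewrite lee_fin ge_min lexx.
have yz : edist (y, z) = (qdist y z)%:E.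
  apply: trunc_dist_edist_le => //.
  apply: le_trans (edist_triangle y x z) _.
  rewrite edist_sym; apply: le_trans (leeD (ltW xy) (ltW xz)) _.
  rewrite -EFinD lee_fin.
  have : Num.min rho (pi / 4) <= pi / 4 by rewrite ge_min lexx orbT.
  lra.
rewrite yz/= evol_diff// normrM gtr0_norm ?invr_gt0 ?mulr_gt0//.
rewrite ler_pdivrMl ?mulr_gt0//.
rewrite distrC; apply: le_trans (h z y (near_qdist _ xz) (near_qdist _ xy)) _.
rewrite /qdist trunc_dist_sym le_eqVlt; apply/orP; left; apply/eqP; field.
by rewrite gt_eqF.
Qed.

Lemma evol_slope_ge t x : is_length_space X -> 0 < t < T ->
  ((Num.sqrt (gap t x) / t)%:E <= slope (evol t xi) x)%E.
Proof.
move=> len tT; have [t0 tT'] : 0 < t /\ 0 < t <= T by lra.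
have g0 := gap_ge0 t x tT; have s0 := sqrtr_ge0 (gap t x).
have [->|sn0] := eqVneq (Num.sqrt (gap t x)) 0.
  by rewrite mul0r slope_ge0.
have {}s0 : 0 < Num.sqrt (gap t x) by rewrite lt_neqAle eq_sym sn0.
apply: slope_ge => eta rho eta0 rho0.
have et0 : 0 < eta * t by rewrite mulr_gt0.
have kg : Num.sqrt (gap t x) ^+ 2 <= gap t x by rewrite sqr_sqrtr.
have [y [d [d0r xy h]]] := marginal_slope_ge t x _ _ rho len tT s0 kg et0 rho0.
exists y, d; split => //.
rewrite distrC evol_diff// normrM gtr0_norm ?invr_gt0 ?mulr_gt0//.
rewrite ler_pdivlMl ?mulr_gt0//.
apply: le_trans (ler_norm _); apply: le_trans h.
rewrite le_eqVlt; apply/orP; left; apply/eqP; field.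
by rewrite gt_eqF.
Qed.

(** * The Hopf-Lax formula on the cone *)

Definition cost t x y : R := (2 * t)^-1 * (1 - payoff t x y).

Lemma evol_le_cost t x y : 0 < t <= T -> evol t xi x <= cost t x y.
Proof.
move=> /andP[t0 tT]; rewrite evol_marginal ?t0//.
rewrite ler_pM2l ?invr_gt0 ?mulr_gt0// lerD2l lerN2.
by apply: payoff_le_marginal; rewrite ltW.
Qed.

Lemma cos_qdist_ge0 x y : 0 <= cos (qdist x y).
Proof.
apply: cos_ge0_pihalf; have := qdist_itv x y; have := pihalf_ge0; lra.
Qed.

(** The cone distance truncates at [pi], the evolution at [pi / 2].  Beyond
    [pi / 2] the cosine is nonpositive and the vertex is the best competitor,
    which is what the value 0 of the truncated cosine encodes. *)
Lemma cos_trunc_pi x y :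
  cos (trunc_dist pi x y) = cos (qdist x y) \/
  cos (qdist x y) = 0 /\ cos (trunc_dist pi x y) <= 0.
Proof.
have pi0 := pi_ge0 R; have pigt := pi_gt0 R.
have [lt|ge] := ltP (qdist x y) (pi / 2); [left|right].
  have e : edist (x, y) = (qdist x y)%:E by apply: trunc_dist_lt.
  congr cos; apply: EFin_inj; rewrite trunc_distE// e min_l// lee_fin.
  by rewrite /qdist in lt *; lra.
have qE : qdist x y = pi / 2.
  by apply/eqP; rewrite eq_le ge andbT; have /andP[] := qdist_itv x y.
split; first by rewrite qE cos_pihalf.
have ge' : pi / 2 <= trunc_dist pi x y.
  rewrite -lee_fin trunc_distE// le_min lee_fin; apply/andP; split; last lra.
  by rewrite -qE; exact: trunc_dist_le_edist.
rewrite -[leRHS](@cos_pihalf R).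
have [->//|neq] := eqVneq (trunc_dist pi x y) (pi / 2).
have tle : trunc_dist pi x y <= pi by exact: trunc_dist_le.
apply: ltW; rewrite ltr_cos ?in_itv/=; [|lra|lra].
by rewrite lt_neqAle eq_sym neq.
Qed.

(** Once the cosine is replaced by the one truncated at [pi / 2], the
    difference of the two sides is a square that vanishes at the best
    radius. *)
Lemma cone_value_ge t x y (r s : R) : 0 < t <= T -> 0 <= r -> 0 <= s ->
  cost t x y * r ^+ 2 <= xi y * s ^+ 2 + (2 * t)^-1 *
    (r ^+ 2 + s ^+ 2 - 2 * r * s * cos (trunc_dist pi x y)).
Proof.
move=> /andP[t0 tT] r0 s0; have tT' : 0 <= t <= T by rewrite ltW.
have wpos : 0 < 1 + 2 * t * xi y by rewrite (lt_le_trans m0)// wm.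
have cle : cos (trunc_dist pi x y) <= cos (qdist x y).
  have [->//|[_ h]] := cos_trunc_pi x y; exact: le_trans h (cos_qdist_ge0 x y).
have rs0 : 0 <= 2 * r * s by rewrite mulr_ge0// mulr_ge0.
apply: (@le_trans _ _ (xi y * s ^+ 2 + (2 * t)^-1 *
    (r ^+ 2 + s ^+ 2 - 2 * r * s * cos (qdist x y)))); last first.
  by rewrite lerD2l ler_pM2l ?invr_gt0 ?mulr_gt0// lerD2l lerN2 ler_wpM2l.
rewrite -subr_ge0.
have -> : xi y * s ^+ 2 + (2 * t)^-1 *
    (r ^+ 2 + s ^+ 2 - 2 * r * s * cos (qdist x y)) - cost t x y * r ^+ 2 =
  (2 * t)^-1 * (1 + 2 * t * xi y) * (s - r * cos (qdist x y) * weight t y) ^+ 2.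
  rewrite /cost /payoff /cos2 /weight; field.
  by rewrite !gt_eqF.
by rewrite mulr_ge0 ?sqr_ge0// mulr_ge0 ?invr_ge0 ?mulr_ge0// ltW.
Qed.

Definition best_radius t x y (r : R) : R := r * cos (qdist x y) * weight t y.

Lemma cone_value_best t x y (r : R) : 0 < t <= T ->
  let s := best_radius t x y r in
  xi y * s ^+ 2 + (2 * t)^-1 *
    (r ^+ 2 + s ^+ 2 - 2 * r * s * cos (trunc_dist pi x y)) =
  cost t x y * r ^+ 2.
Proof.
move=> /andP[t0 tT] s; rewrite {}/s /best_radius.
have tT' : 0 <= t <= T by rewrite ltW.
have wpos : 0 < 1 + 2 * t * xi y by rewrite (lt_le_trans m0)// wm.
rewrite /cost /payoff /cos2 /weight.
by have [->|[-> _]] := cos_trunc_pi x y; field; rewrite !gt_eqF.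
Qed.

Lemma hopf_lax_on_evol (A : set (cone X)) t x (r : {nonneg R}) : 0 < t <= T ->
  (forall y (s : {nonneg R}), s%:num = best_radius t x y r%:num ->
    A (cone_pt y s)) ->
  hopf_lax_on A t (cone_quad xi) (cone_pt x r) =
    (evol t xi x * r%:num ^+ 2)%:E.
Proof.
move=> tT hA; have /andP[t0 tleT] := tT; have tT' : 0 <= t <= T by rewrite ltW.
rewrite /hopf_lax_on gt_eqF//; apply/eqP; rewrite eq_le; apply/andP; split.
  apply/lee_addgt0Pr => e e0; rewrite -EFinD.
  have r20 : 0 < r%:num ^+ 2 + 1 by rewrite ltr_wpDl// sqr_ge0.
  pose e' := 2 * t * e / (r%:num ^+ 2 + 1).
  have e'0 : 0 < e' by rewrite divr_gt0 ?mulr_gt0.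
  have [y hy] := marginal_approx t x e' tT' e'0.
  have s0 : 0 <= best_radius t x y r%:num.
    by rewrite !mulr_ge0 ?cos_qdist_ge0// ltW// weight_gt0.
  apply: ge_ereal_inf; exists (cost t x y * r%:num ^+ 2)%:E.
    exists (cone_pt y (NngNum s0)); first exact: hA.
    by rewrite cone_quadE cone_sqdistE/= cone_value_best.
  rewrite lee_fin evol_marginal// /cost.
  apply: (@le_trans _ _ ((2 * t)^-1 * (1 - marginal t x + e') * r%:num ^+ 2)).
    rewrite ler_wpM2r ?sqr_ge0// ler_pM2l ?invr_gt0 ?mulr_gt0//; lra.
  have -> : (2 * t)^-1 * (1 - marginal t x + e') * r%:num ^+ 2 =
    (2 * t)^-1 * (1 - marginal t x) * r%:num ^+ 2 +
      (r%:num ^+ 2 / (r%:num ^+ 2 + 1)) * e.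
    by rewrite /e'; field; rewrite !gt_eqF.
  rewrite lerD2l ler_piMl ?(ltW e0)// ler_pdivrMr// mul1r lerDl//.
apply: le_ereal_inf_tmp => _ [y' _ <-]; rewrite -[y']reprK.
case: (repr y') => y s; rewrite -/(cone_pt y s) cone_quadE cone_sqdistE lee_fin.
apply: le_trans (cone_value_ge t x y r%:num s%:num tT _ _) => //.
by rewrite ler_wpM2r ?sqr_ge0// evol_le_cost.
Qed.

Lemma best_radius_le t x y (r I : R) : 0 < t <= T -> 0 <= r ->
  0 < 1 + 2 * t * I -> I <= xi y ->
  best_radius t x y r <= r / (1 + 2 * t * I).
Proof.
move=> tT r0 I0 Ixi; have tT' : 0 <= t <= T by lra.
have t0 : 0 < 2 * t by lra.
rewrite /best_radius; apply: ler_pM.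
- by rewrite mulr_ge0// cos_qdist_ge0.
- exact/ltW/weight_gt0.
- by rewrite ler_piMr// cos_le1.
- rewrite lef_pV2 ?posrE//; last by rewrite (lt_le_trans m0)// wm.
  by rewrite lerD2l ler_pM2l.
Qed.

(** * Regularity of the evolution in time and space *)

Context (K : R) (xiK : forall x y, `|xi x - xi y| <= K * qdist x y).

Lemma sin_qdist_ge0 x y : 0 <= sin (qdist x y).
Proof.
apply: sin_ge0_pi; have := qdist_itv x y; have := pi_ge0 R; lra.
Qed.

Lemma xi_sin_lip x y : 0 <= K -> `|xi x - xi y| <= 2 * K * sin (qdist x y).
Proof.
move=> K0; apply: le_trans (xiK x y) _; rewrite (mulrC 2) -mulrA ler_wpM2l//.
exact/le_double_sin/qdist_itv.
Qed.

Let C := 4 * K * m^-1.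

(** If [y] is at least as good as [x] itself, then the squared sine is at most
    [2 t (xi x - xi y) m^-1], and the difference of the values of [xi] is at
    most [2 K sin (qdist x y)]; one factor of the sine cancels. *)
Lemma near_minimizer_close t x y : 0 <= K -> 0 < t <= T ->
  payoff t x x <= payoff t x y -> sin (qdist x y) <= C * t.
Proof.
move=> K0 /andP[t0 tT]; have tT' : 0 <= t <= T by rewrite ltW.
have s0 := sin_qdist_ge0 x y.
have wx := weight_gt0 t x tT'; have wy := weight_gt0 t y tT'.
have wV := weight_le t x tT'.
rewrite /payoff cos2_refl mul1r /cos2 cos2sin2 => h.
have e : weight t y - weight t x =
    2 * t * (xi x - xi y) * weight t x * weight t y.
  rewrite /weight; field.
  by rewrite !gt_eqF// (lt_le_trans m0)// wm.
have h1 : sin (qdist x y) ^+ 2 * weight t y <=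
    2 * t * (xi x - xi y) * weight t x * weight t y by lra.
rewrite ler_pM2r// in h1.
have /ler_normlW h2 := xi_sin_lip x y K0.
have h3 : sin (qdist x y) ^+ 2 <= C * t * sin (qdist x y).
  apply: le_trans h1 _.
  have -> : C * t * sin (qdist x y) = 2 * t * (2 * K * sin (qdist x y)) * m^-1.
    by rewrite /C; ring.
  have t20 : 0 <= 2 * t by rewrite mulr_ge0// ltW.
  apply: (@le_trans _ _ (2 * t * (2 * K * sin (qdist x y)) * weight t x)).
    by rewrite ler_wpM2r ?(ltW wx)// ler_wpM2l.
  by rewrite ler_wpM2l// mulr_ge0// !mulr_ge0.
have [->|sn0] := eqVneq (sin (qdist x y)) 0.
  apply: mulr_ge0; last exact: ltW.
  by rewrite /C mulr_ge0 ?mulr_ge0 ?invr_ge0// ltW.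
by rewrite expr2 ler_pM2r// lt_neqAle eq_sym sn0 in h3.
Qed.

(** A lower bound for the cost on the ball of radius [O(t)] suffices: by
    [near_minimizer_close], every point outside costs more than [x], which
    lies inside. *)
Lemma le_evol_of_close t x (r : R) : 0 <= K -> 0 < t <= T ->
  (forall y, sin (qdist x y) <= C * t -> r <= cost t x y) -> r <= evol t xi x.
Proof.
move=> K0 tT h; have /andP[t0 _] := tT.
have t20 : 0 < 2 * t by rewrite mulr_gt0.
have hr y : payoff t x x <= payoff t x y -> payoff t x y <= 1 - 2 * t * r.
  move=> /(near_minimizer_close t x y K0 tT)/h.
  by rewrite /cost ler_pdivlMl//; lra.
rewrite evol_marginal// ler_pdivlMl// lerBrDl -lerBrDr.
apply: marginal_le => y; have [|/ltW yx] := leP (payoff t x x) (payoff t x y).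
  exact: hr.
by apply: le_trans yx _; exact: hr.
Qed.

Lemma costE t x y : 0 < t <= T -> cost t x y =
  xi y * weight t y + sin (qdist x y) ^+ 2 * weight t y / (2 * t).
Proof.
move=> /andP[t0 tT]; rewrite /cost /payoff /cos2 cos2sin2 /weight; field.
by rewrite !gt_eqF// (lt_le_trans m0)// wm// ltW.
Qed.

Lemma evol_le_xi t x : 0 < t <= T -> evol t xi x <= xi x.
Proof.
move=> tT; apply: le_trans (evol_le_cost t x x tT) _; rewrite costE//.
have tT' : 0 <= t <= T by lra.
rewrite /qdist trunc_dist_refl// sin0 expr0n/= !mul0r addr0.
rewrite -subr_ge0.
have -> : xi x - xi x * weight t x = xi x * ((1 + 2 * t * xi x) * weight t x) -
  xi x * weight t x by rewrite weight_mulV// mulr1.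
have -> : xi x * ((1 + 2 * t * xi x) * weight t x) - xi x * weight t x =
  2 * t * xi x ^+ 2 * weight t x by ring.
rewrite mulr_ge0//; last exact/ltW/weight_gt0.
by rewrite mulr_ge0 ?sqr_ge0//; lra.
Qed.

Let C0 := 2 * K * C + 2 * B ^+ 2 * m^-1.

Lemma xi_le_evol t x : 0 <= K -> 0 < t <= T -> xi x - C0 * t <= evol t xi x.
Proof.
move=> K0 tT; apply: le_evol_of_close => // y hy; rewrite costE//.
have tT' : 0 <= t <= T by lra.
have t0 : 0 <= t by lra.
have w0 := ltW (weight_gt0 t y tT'); have wV := weight_le t y tT'.
have p0 : 0 <= sin (qdist x y) ^+ 2 * weight t y / (2 * t).
  apply: divr_ge0; last exact: mulr_ge0.
  by apply: mulr_ge0 => //; exact: sqr_ge0.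
have /ler_normlW h := xi_sin_lip x y K0.
have : xi y - 2 * t * B ^+ 2 * m^-1 <= xi y * weight t y.
  have -> : xi y * weight t y = xi y * ((1 + 2 * t * xi y) * weight t y) -
    2 * t * xi y ^+ 2 * weight t y by ring.
  rewrite weight_mulV// mulr1 lerB//.
  apply: ler_pM => //.
    by apply: mulr_ge0; [exact: mulr_ge0|exact: sqr_ge0].
  rewrite ler_wpM2l ?mulr_ge0//.
  by rewrite -[leLHS]real_normK ?num_real// lerXn2r ?nnegrE// (le_trans _ (xiB y)).
have : 2 * K * sin (qdist x y) <= 2 * K * (C * t) by rewrite ler_wpM2l// mulr_ge0.
rewrite /C0; lra.
Qed.

Let M := (2 * B ^+ 2 + C ^+ 2 * (1 + 4 * T * B)) * (m^-1 * m^-1).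

(** The cost contains the squared sine divided by [2 t]; its increment in time
    carries the factor [1 / (s t)], which the hypothesis absorbs. *)
Lemma cost_time_lip s t x y : 0 < s <= T -> 0 < t <= T ->
  sin (qdist x y) ^+ 2 <= 2 * C ^+ 2 * s * t ->
  cost s x y <= cost t x y + M * `|t - s|.
Proof.
move=> sT tT hs; have [s0 t0] : 0 < s /\ 0 < t by lra.
have sT' : 0 <= s <= T by lra. have tT' : 0 <= t <= T by lra.
rewrite -lerBlDl !costE//.
set sg := sin (qdist x y) ^+ 2.
have ws := ltW (weight_gt0 s y sT'); have wsV := weight_le s y sT'.
have wt := ltW (weight_gt0 t y tT'); have wtV := weight_le t y tT'.
have -> : xi y * weight s y + sg * weight s y / (2 * s) -
    (xi y * weight t y + sg * weight t y / (2 * t)) =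
  ((2 * xi y ^+ 2 + sg / (2 * s * t) * (1 + 2 * (s + t) * xi y)) *
    (weight s y * weight t y)) * (t - s).
  rewrite /weight; field.
  by rewrite !gt_eqF// (lt_le_trans m0)// wm.
apply: le_trans (ler_norm _) _; rewrite normrM ler_wpM2r//.
rewrite normrM (ger0_norm (mulr_ge0 ws wt)) /M.
have B0 : 0 <= B by apply: le_trans (xiB y).
have xi2 : xi y ^+ 2 <= B ^+ 2.
  by rewrite -[leLHS]real_normK ?num_real// lerXn2r ?nnegrE.
have q0 : 0 <= sg / (2 * s * t).
  by rewrite divr_ge0 ?sqr_ge0// !mulr_ge0// ltW.
apply: ler_pM => //; [exact: mulr_ge0| |exact: ler_pM].
apply: le_trans (ler_normD _ _) _; apply: lerD.
  rewrite ger0_norm; first by rewrite ler_wpM2l.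
  by apply: mulr_ge0 => //; exact: sqr_ge0.
rewrite normrM (ger0_norm q0); apply: ler_pM => //.
  rewrite ler_pdivrMr ?mulr_gt0//; apply: le_trans hs _.
  by rewrite le_eqVlt; apply/orP; left; apply/eqP; ring.
apply: le_trans (ler_normD _ _) _; rewrite normr1 lerD2l.
have st0 : 0 <= 2 * (s + t) by lra.
by rewrite normrM (ger0_norm st0); apply: ler_pM => //; lra.
Qed.

(** When [t <= 2 s], the competitors at time [t] satisfy the hypothesis of
    [cost_time_lip].  Otherwise [t <= 2 |s - t|], and it is enough that
    [xi_s <= xi] and [xi <= xi_t + C0 t]. *)
Lemma evol_time_lip : 0 <= K -> 0 <= B -> 0 <= T -> exists2 L : R, 0 <= L &
  forall s t x, 0 <= s <= T -> 0 <= t <= T ->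
    `|evol s xi x - evol t xi x| <= L * `|s - t|.
Proof.
move=> K0 B0 T0.
have Cge0 : 0 <= C by rewrite !mulr_ge0 ?invr_ge0// ltW.
have mV0 : 0 <= m^-1 by rewrite invr_ge0 ltW.
have C00 : 0 <= C0.
  by rewrite addr_ge0 ?mulr_ge0 ?sqr_ge0.
have M0 : 0 <= M.
  by rewrite mulr_ge0 ?addr_ge0 ?mulr_ge0 ?sqr_ge0 ?addr_ge0 ?mulr_ge0.
exists (M + 2 * C0); first by rewrite addr_ge0// mulr_ge0.
suff H s t x : 0 <= s <= T -> 0 <= t <= T ->
    evol s xi x <= evol t xi x + (M + 2 * C0) * `|s - t|.
  move=> s t x sT tT; rewrite ler_distl.
  have := H s t x sT tT; have := H t s x tT sT; rewrite (distrC t); lra.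
move=> sT tT.
have d0 := normr_ge0 (s - t).
have Md : 0 <= M * `|s - t| by rewrite mulr_ge0.
have Cd : 0 <= C0 * `|s - t| by rewrite mulr_ge0.
have [t0|t0] := eqVneq t 0.
  have -> : evol t xi x = xi x by rewrite /evol t0 eqxx.
  have [s0|s0] := eqVneq s 0.
    have -> : evol s xi x = xi x by rewrite /evol s0 eqxx.
    lra.
  have sT' : 0 < s <= T by rewrite lt_neqAle eq_sym s0.
  by have := evol_le_xi s x sT'; lra.
have tT' : 0 < t <= T by rewrite lt_neqAle eq_sym t0.
have xt := xi_le_evol t x K0 tT'.
have far : 2 * s < t -> C0 * t <= 2 * C0 * `|s - t|.
  move=> st; rewrite (mulrC 2) -mulrA ler_wpM2l//.
  by rewrite ltr0_norm; lra.
have [s0|s0] := eqVneq s 0.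
  have -> : evol s xi x = xi x by rewrite /evol s0 eqxx.
  by have := far ltac:(lra); lra.
have sT' : 0 < s <= T by rewrite lt_neqAle eq_sym s0.
have [st|st] := ltP (2 * s) t.
  by have := far st; have := evol_le_xi s x sT'; lra.
suff : evol s xi x - M * `|s - t| <= evol t xi x by lra.
apply: le_evol_of_close => // y hy.
have sq : sin (qdist x y) ^+ 2 <= 2 * C ^+ 2 * s * t.
  have := sin_qdist_ge0 x y => sg0.
  apply: (@le_trans _ _ ((C * t) ^+ 2)).
    by rewrite lerXn2r ?nnegrE// (le_trans sg0).
  have -> : (C * t) ^+ 2 = C ^+ 2 * t * t by ring.
  rewrite ler_wpM2r//; first lra.
  have -> : 2 * C ^+ 2 * s = C ^+ 2 * (2 * s) by ring.
  by rewrite ler_wpM2l// sqr_ge0.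
have := cost_time_lip s t x y sT' tT' sq; have := evol_le_cost s x y sT'.
rewrite distrC; lra.
Qed.

Lemma evol_space_lip t x y : 0 < t <= T ->
  `|evol t xi x - evol t xi y| <= (2 * t)^-1 * m^-1 * qdist x y.
Proof.
move=> tT; rewrite evol_diff// normrM gtr0_norm ?invr_gt0 ?mulr_gt0//; last lra.
rewrite -mulrA ler_pM2l ?invr_gt0 ?mulr_gt0//; last lra.
by rewrite distrC; apply: marginal_lip; lra.
Qed.

Lemma evol_bounded t x : 0 < t <= T ->
  `|evol t xi x| <= (2 * t)^-1 * (1 + m^-1).
Proof.
move=> tT; have tT' : 0 <= t <= T by lra.
rewrite evol_marginal// normrM gtr0_norm ?invr_gt0 ?mulr_gt0//; last lra.
rewrite ler_pM2l ?invr_gt0 ?mulr_gt0//; last lra.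
have := marginal_ge0 t x tT'; have := marginal_leV t x tT'.
by move=> h1 h2; apply/ler_normlP; split; lra.
Qed.

End Marginal.

(** * Bounded Lipschitz functions *)

Section LipschitzFunctions.
Context (R : realType) (X : pseudoMetricType R).

Lemma Lipb_of_qdist_lip (f : X -> R) (M L : R) :
  (forall x, `|f x| <= M) -> 0 < L ->
  (forall x y, `|f x - f y| <= L * qdist R X x y) -> Lipb f.
Proof.
move=> fM L0 fL; split.
  exists M; split; first exact: num_real.
  by move=> r Mr x _ /=; rewrite (le_trans (fM x))// ltW.
exists L => // x y; apply: (@le_trans _ _ ((L * qdist R X x y)%:E)).
  by rewrite lee_fin.
rewrite EFinM; apply: lee_wpmul2l; first by rewrite lee_fin ltW.
by apply: trunc_dist_le_edist; rewrite divr_ge0// pi_ge0.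
Qed.

Lemma Lipb_continuous (f : X -> R) : Lipb f -> continuous f.
Proof.
move=> [_ [L L0 fL]] x; apply/cvgrPdist_lt => e e0.
have eL : 0 < e / L / 2 by rewrite !divr_gt0.
near=> y.
have xy : ball x (e / L / 2) y by near: y; apply: nbhsx_ballx.
have := @edist_fin _ _ _ (x, y) eL xy => d.
rewrite -lte_fin; apply: le_lt_trans (fL x y) _.
apply: (@le_lt_trans _ _ (L%:E * (e / L / 2)%:E)%E).
  by apply: lee_wpmul2l => //; rewrite lee_fin ltW.
rewrite -EFinM lte_fin.
have -> : L * (e / L / 2) = e / 2 by field; rewrite gt_eqF.
by rewrite ltr_pdivrMr// mulr_natr mulr2n ltrDl.
Unshelve. all: by end_near. Qed.

(** For a bounded function, truncating the distance only costs a larger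
    Lipschitz constant. *)
Lemma Lipb_qdist_lip (f : X -> R) : Lipb f -> exists M L : R,
  [/\ 0 <= M, 0 < L, (forall x, `|f x| <= M) &
      (forall x y, `|f x - f y| <= L * qdist R X x y)].
Proof.
move=> [[M [_ fM]] [L L0 fL]].
pose M' := `|M| + 1.
have fM' x : `|f x| <= M'.
  by apply: (fM M') => //; rewrite /M'; have := ler_norm M; lra.
have M'0 : 0 <= M' by rewrite addr_ge0.
exists M', (L + 2 * M'); split => //; first by rewrite ltr_wpDr// mulr_ge0.
move=> x y; have q0 := qdist_ge0 R X x y.
have pi0 := pihalf_ge0 R.
rewrite mulrDl.
have [lt|ge] := ltP (qdist R X x y) (pi / 2).
  apply: ler_wpDr; first by rewrite !mulr_ge0.
  by have := fL x y; rewrite (trunc_dist_lt _ _ _ _ _ pi0 lt) -EFinM lee_fin.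
apply: ler_wpDl; first by rewrite mulr_ge0// ltW.
have p1 := pihalf_ge1 R.
apply: le_trans (ler_normB _ _) _.
apply: (@le_trans _ _ (2 * M')); first by have := fM' x; have := fM' y; lra.
apply: ler_peMr; first exact: mulr_ge0.
exact: le_trans p1 ge.
Qed.

End LipschitzFunctions.
(** * The generalized Hopf-Lax evolution *)

(* Two necessary corrections of the claim "for all t in [0, 1]":
   - the formula with r' <= rho also assumes r <= (1 + 2 t inf xi) rho.  This
     follows from r <= P rho if P <= 1, but the formula fails without it, e.g.
     for X a point, xi = 10, rho = 1, r = P rho and t small;
   - the differential (in)equalities are claimed for t in (0, 1].  They fail
     at t = 0, e.g. for X the real line, xi y = min(|y|, 1) and x = 0, where
     xi_t(0) = 0 for all t but the asymptotic Lipschitz constant of xi is 1. *)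
Theorem theorem8p11 (R : realType) (X : completePseudoMetricType R)
    (xi : X -> R) :
  hausdorff_space X -> separable_space X -> Lipb xi ->
  let P := inf (range xi) + 1 / 2 in
  0 < P ->
  [/\ (forall (t : R) (x : X) (r : {nonneg R}), 0 <= t <= 1 ->
         hopf_lax t (cone_quad xi) (cone_pt x r)
         = (evol t xi x * r%:num ^+ 2)%:E),
      (forall (t : R) (x : X), 0 < t <= 1 ->
         evol t xi x =
         inf [set 1 / (2 * t)
                  * (1 - cos (trunc_dist (pi / 2) x x') ^+ 2
                         / (1 + 2 * t * xi x')) | x' in [set: X]]),
      (forall (t rho : R) (x : X) (r : {nonneg R}), 0 <= t <= 1 -> 0 < rho ->
         r%:num <= P * rho ->
         r%:num <= (1 + 2 * t * inf (range xi)) * rho ->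
         (evol t xi x * r%:num ^+ 2)%:E
         = hopf_lax_on [set y | cone_radius y <= rho] t (cone_quad xi)
             (cone_pt x r)) &
   [/\ (forall t : R, 0 <= t <= 1 -> Cb (evol t xi) /\ Lipb (evol t xi)),
      (exists L : R, forall s t : R, 0 <= s <= 1 -> 0 <= t <= 1 ->
         (unif_norm (fun x => evol s xi x - evol t xi x)%R
          <= (L * `|s - t|)%:E)%E),
      (forall (t : R) (x : X), 0 < t <= 1 ->
         exists2 l : R, is_right_derivative (fun s => evol s xi x) t l &
           (l%:E + (1 / 2)%:E * asym_lip (evol t xi) x ^+ 2
            + (2 * evol t xi x ^+ 2)%:E <= 0)%E),
      (forall x : X,
         countable [set t : R | 0 <= t <= 1 /\
                                ~ derivable (fun s => evol s xi x) t 1]) &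
      (is_length_space X ->
       forall (t : R) (x : X), 0 < t <= 1 ->
         (exists2 l : R, is_right_derivative (fun s => evol s xi x) t l &
           (l%:E + (1 / 2)%:E * asym_lip (evol t xi) x ^+ 2
            + (2 * evol t xi x ^+ 2)%:E = 0)%E) /\
         asym_lip (evol t xi) x = slope (evol t xi) x)]].
Proof.
move=> _ _ xiLip P P0.
have [B [L [B0 L0 xiB xiL]]] := Lipb_qdist_lip _ _ _ xiLip.
set I := inf (range xi) in P P0 *.
have Ixi y : I <= xi y.
  apply: ge_inf; last by exists y.
  by exists (- B) => _ [z _ <-]; have /ler_normlP[] := xiB z; lra.
(* With [I = P - 1 / 2], the denominator [1 + 2 t I] equals [1 - t + 2 t P]: it
   is at least [min 1 (2 P)] for [t <= 1] and at least [P] up to [t = 1 + P]. *)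
pose T : R := 1 + P; pose m := Num.min 1 P.
have m0 : 0 < m by rewrite lt_min ltr01.
have m1 : m <= 1 by rewrite ge_min lexx.
have mP : m <= P by rewrite ge_min lexx orbT.
have wI (t : R) : 0 <= t <= T -> m <= 1 + 2 * t * I.
  move=> /andP[t0 tT]; rewrite /P in mP P0 *; have [t1|t1] := leP t 1.
    have [I0|I0] := leP 0 I; first by have := mulr_ge0 t0 I0; lra.
    have : t * - I <= 1 * - I by rewrite ler_wpM2r//; lra.
    lra.
  rewrite /T /P in tT.
  have : 1 * (I + 1 / 2) <= t * (I + 1 / 2) by rewrite ler_wpM2r//; lra.
  lra.
have wm (t : R) y : 0 <= t <= T -> m <= 1 + 2 * t * xi y.
  move=> tT; apply: le_trans (wI t tT) _; rewrite lerD2l ler_wpM2l//; lra.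
have toT (t : R) : 0 < t <= 1 -> 0 < t < T by rewrite /T; lra.
have toT' (t : R) : 0 < t <= 1 -> 0 < t <= T by rewrite /T; lra.
have toT0 (t : R) : 0 <= t <= 1 -> 0 <= t <= T by rewrite /T; lra.
have evol0 : evol 0 xi = xi by apply/funext => x; rewrite /evol eqxx.
have pos (t : R) : 0 <= t <= 1 -> t != 0 -> 0 < t <= 1.
  by move=> /andP[t0 ->] tn0; rewrite lt_neqAle eq_sym tn0 t0.
split.
- move=> t x r t01; have [->|tn0] := eqVneq t 0.
    by rewrite evol0 /hopf_lax /hopf_lax_on eqxx cone_quadE.
  rewrite /hopf_lax (hopf_lax_on_evol R X xi T m m0 wm)//.
  exact: (toT' _ (pos _ t01 tn0)).
- move=> t x t01; have t0 : 0 < t by lra.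
  rewrite /evol gt_eqF//; congr inf; apply: eq_imagel => y _.
  rewrite cos2sin2; field.
  by rewrite !gt_eqF// (lt_le_trans m0)// wm// toT0//; lra.
- move=> t rho x r t01 rho0 _ rrho; have [->|tn0] := eqVneq t 0.
    by rewrite evol0 /hopf_lax_on eqxx cone_quadE.
  have tT := toT' _ (pos _ t01 tn0).
  have wI0 : 0 < 1 + 2 * t * I by apply: lt_le_trans m0 (wI t (toT0 t t01)).
  rewrite (hopf_lax_on_evol R X xi T m m0 wm)// => y s sE.
  rewrite /= cone_radiusE sE.
  apply: le_trans (best_radius_le R X xi T m m0 wm t x y r%:num I tT _ wI0 (Ixi y)) _ => //.
  by rewrite ler_pdivrMr// [leRHS]mulrC.
have mV0 : 0 < m^-1 by rewrite invr_gt0.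
have gap0 (t : R) x : 0 < t <= 1 -> 0 <= gap R X xi t x.
  by move=> /toT; exact: (gap_ge0 R X xi T m m0 wm).
have rateE (t : R) x : 0 < t <= 1 ->
    evol_rate R X xi t x + 2 * evol t xi x ^+ 2 =
    - (1 / 2) * (gap R X xi t x / t ^+ 2).
  by move=> /toT'; exact: (evol_rateE R X xi T m m0 wm).
have asymE (t : R) x : 0 < t <= 1 -> exists a : R,
    0 <= a <= Num.sqrt (gap R X xi t x) / t /\ asym_lip (evol t xi) x = a%:E.
  move=> t01.
  have al := evol_asym_lip_le R X xi T m m0 wm t x (toT _ t01).
  have a0 : (0 <= asym_lip (evol t xi) x)%E.
    exact: le_trans (slope_ge0 _ _ _ _) (slope_le_asym_lip _ _ _ _).
  have afin : asym_lip (evol t xi) x \is a fin_num.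
    by rewrite ge0_fin_numE// (le_lt_trans al (ltry _)).
  exists (fine (asym_lip (evol t xi) x)); rewrite fineK//; split => //.
  by rewrite fine_ge0//= -lee_fin fineK.
split.
- move=> t t01; suff Lt : Lipb (evol t xi).
    by split => //; split; [case: Lt|exact: Lipb_continuous].
  have [->|tn0] := eqVneq t 0; first by rewrite evol0.
  have tT := toT' _ (pos _ t01 tn0); have t0 : 0 < 2 * t by lra.
  apply: (Lipb_of_qdist_lip _ _ _ ((2 * t)^-1 * (1 + m^-1)) ((2 * t)^-1 * m^-1)).
  + by move=> x; apply: (evol_bounded R X xi T m m0 wm).
  + by rewrite mulr_gt0// invr_gt0.
  + by move=> x y; apply: (evol_space_lip R X xi T m m0 wm).
- have T0 : 0 <= T by rewrite addr_ge0// ltW.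
  have [L' L'0 h] := evol_time_lip R X xi T m B m0 wm xiB L xiL (ltW L0) B0 T0.
  exists L' => s t s01 t01; apply: ge_ereal_sup => _ [x _ <-].
  by rewrite lee_fin; apply: h; exact: toT0.
- move=> t x t01; have t0 : 0 < t by lra.
  exists (evol_rate R X xi t x).
    exact: (evol_right_derivative R X xi T m m0 wm _ _ (toT _ t01)).
  have [a [/andP[a0 ale] ->]] := asymE t x t01.
  rewrite -EFin_expe -!EFinM -!EFinD lee_fin addrAC rateE//.
  have := lerXn2r 2 a0 (le_trans a0 ale) ale.
  by rewrite expr_div_n sqr_sqrtr ?gap0//; lra.
- move=> x; apply: sub_countable (evol_countable_not_derivable R X xi T m m0 wm x).
  apply: subset_card_le => t [t01 dt]; split => //.
  by rewrite /T; lra.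
- move=> len t x t01.
  have sa := slope_le_asym_lip R X (evol t xi) x.
  have al := evol_asym_lip_le R X xi T m m0 wm t x (toT _ t01).
  have sl := evol_slope_ge R X xi T m B m0 wm xiB t x len (toT _ t01).
  have aE : asym_lip (evol t xi) x = (Num.sqrt (gap R X xi t x) / t)%:E.
    by apply/eqP; rewrite eq_le al (le_trans sl sa).
  split; last by apply/eqP; rewrite eq_le sa aE sl.
  exists (evol_rate R X xi t x).
    exact: (evol_right_derivative R X xi T m m0 wm _ _ (toT _ t01)).
  rewrite aE -EFin_expe -!EFinM -!EFinD addrAC rateE//.
  rewrite expr_div_n sqr_sqrtr ?gap0//; congr EFin; ring.
Qed.
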